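(* Let $H$ be a colour Hopf algebra and $A$ a graded $H$-comodule colour algebra. Set $B=A^{coH}$. Let $M\in{}_{\mathrm{gr}\text{-}A}^{\mathrm{gr}\text{-}H}\mathcal M$ and $N\in{}_{\mathrm{gr}\text{-}B}\mathcal M$. There is a functorial $\Bbbk$-linear isomorphism $$\Psi:{}_{\mathrm{gr}\text{-}A}^{\mathrm{gr}\text{-}H}\mathrm{Hom}(A\otimes_B N,M)\to{}_{\mathrm{gr}\text{-}B}\mathrm{Hom}(N,M^{coH}),\qquad f\mapsto[n\mapsto f(1_A\otimes_B n)],$$ with inverse map $\Psi'$ given by $g\mapsto[a\otimes_B n\mapsto a\,g(n)]$. Thus the functors $$F=A\otimes_B-:{}_{\mathrm{gr}\text{-}B}\mathcal M\to{}_{\mathrm{gr}\text{-}A}^{\mathrm{gr}\text{-}H}\mathcal M,\qquad G=(-)^{coH}:{}_{\mathrm{gr}\text{-}A}^{\mathrm{gr}\text{-}H}\mathcal M\to{}_{\mathrm{gr}\text{-}B}\mathcal M$$ form an adjoint pair ($F$ left adjoint to $G$) with unit and counit $$\eta_N:N\to(A\otimes_B N)^{coH},\ n\mapsto 1_A\otimes_B n,\qquad \alpha_M:A\otimes_B M^{coH}\to M,\ a\otimes_B m\mapsto am.$$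
   Context: $\Bbbk$ is a field and $G$ is a multiplicative abelian group (the grading group; not to be confused with the functor $G$) with identity $e$ and a bicharacter $(\cdot/\cdot):G\times G\to\Bbbk^{\times}$, i.e. $(g/g'g'')=(g/g')(g/g'')$ and $(gg'/g'')=(g/g'')(g'/g'')$. ''Graded'' means $G$-graded; $|m|$ is the degree of a homogeneous element $m$; formulas are written for homogeneous elements and extended linearly. A graded map $f:M\to N$ is a $\Bbbk$-linear map with $f(M_g)\subseteq N_g$ for all $g$. $\otimes=\otimes_{\Bbbk}$, graded by $(M\otimes N)_g=\bigoplus_{g'g''=g}M_{g'}\otimes N_{g''}$; $\Bbbk$ is in degree $e$. A colour algebra is a $G$-graded associative unital $\Bbbk$-algebra. A colour Hopf algebra $H$ is a colour algebra which is also a (coassociative, counital) coalgebra with graded maps $\Delta_H$, $\varepsilon_H$ (write $\Delta_H(h)=h_1\otimes h_2$ with homogeneous components), such that $\varepsilon_H$ is a unital algebra map, $\Delta_H(1_H)=1_H\otimes 1_H$, $\Delta_H(hh')=(|h_2|/|h'_1|)\,h_1h'_1\otimes h_2h'_2$, and with a graded map $\mathcal S_H:H\to H$ (antipode) satisfying $h_1\mathcal S_H(h_2)=\varepsilon_H(h)1_H=\mathcal S_H(h_1)h_2$. A graded $H$-comodule is a graded vector space $M$ with a graded map $\chi_M:M\to H\otimes M$, $\chi_M(m)=m_{(-1)}\otimes m_{(0)}$, which is coassociative and counital (left comodule). A graded $H$-colinear map is a graded map $f$ with $f(m)_{(-1)}\otimes f(m)_{(0)}=m_{(-1)}\otimes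 f(m_{(0)})$. Coinvariants: $M^{coH}=\{m\in M:\chi_M(m)=1_H\otimes m\}$, a graded subspace. A graded $H$-comodule colour algebra is a colour algebra $A$ that is a graded $H$-comodule with $\chi_A(1_A)=1_H\otimes 1_A$ and $\chi_A(aa')=(|a_{(0)}|/|a'_{(-1)}|)\,a_{(-1)}a'_{(-1)}\otimes a_{(0)}a'_{(0)}$. For a colour algebra $R$, ${}_{\mathrm{gr}\text{-}R}\mathcal M$ is the category of graded left $R$-modules ($R_gM_{g'}\subseteq M_{gg'}$) with graded $R$-linear maps, with Hom spaces ${}_{\mathrm{gr}\text{-}R}\mathrm{Hom}$. A colour $(A,H)$-Hopf module is a graded left $A$-module and graded $H$-comodule $M$ (same grading) with $\chi_M(am)=(|a_{(0)}|/|m_{(-1)}|)\,a_{(-1)}m_{(-1)}\otimes a_{(0)}m_{(0)}$; ${}_{\mathrm{gr}\text{-}A}^{\mathrm{gr}\text{-}H}\mathcal M$ is the category of these, with graded $A$-linear graded $H$-colinear maps, and Hom spaces ${}_{\mathrm{gr}\text{-}A}^{\mathrm{gr}\text{-}H}\mathrm{Hom}$. $B=A^{coH}$ is a graded subalgebra of $A$ and $M^{coH}$ is a graded left $B$-module. For a graded left $B$-module $N$, $A\otimes_B N$ is a colour $(A,H)$-Hopf module via $a(a'\otimes_B n)=(aa')\otimes_B n$ and $\chi(a\otimes_B n)=a_{(-1)}\otimes a_{(0)}\otimes_B n$. *)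

(* Defs.v *)
From HB Require Import structures.
From mathcomp Require Import all_boot all_order all_algebra.
From mathcomp Require Import mathcomp_extra boolp functions.

Set Implicit Arguments.
Unset Strict Implicit.
Unset Printing Implicit Defensive.

Import GRing.Theory.
Local Open Scope ring_scope.
Local Open Scope quotient_scope.

Definition bilinear_map (k : fieldType) (U V W : lmodType k) (f : U -> V -> W) :=
  (forall u, linear (f u)) /\ (forall v, linear (f^~ v)).

(* [homog V g] is the subspace V_g; the last two axioms say that V is the direct
   sum of the V_g: every vector is a finite sum of homogeneous vectors of
   distinct degrees, and such a sum vanishes only if all its terms do. *)
Record gvect (k : fieldType) (G : groupType) := GVect {
  gv_sort :> lmodType k;
  homog : G -> gv_sort -> Prop;
  homog0 : forall g, homog g 0;
  homogL : forall g (c : k) u v,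
    homog g u -> homog g v -> homog g (c *: u + v);
  homog_span : forall v, exists (s : seq G) (f : G -> gv_sort),
    [/\ uniq s, forall g, homog g (f g) & v = \sum_(g <- s) f g];
  homog_indep : forall (s : seq G) (f : G -> gv_sort),
    uniq s -> (forall g, homog g (f g)) -> \sum_(g <- s) f g = 0 ->
    forall g, g \in s -> f g = 0 }.

Declare Scope gvect_scope.
Delimit Scope gvect_scope with gv.
Bind Scope gvect_scope with gvect.

Arguments homog {k G} V%_gv g v : rename.

Definition graded_map (k : fieldType) (G : groupType) (V W : gvect k G)
    (f : V -> W) :=
  forall g v, homog V g v -> homog W g (f v).

Section Components.
Variables (k : fieldType) (G : groupType) (V : gvect k G).

Fact gdecomp_ex (v : V) : exists p : seq G * (G -> V),
  [/\ uniq p.1, forall g, homog V g (p.2 g) & v = \sum_(g <- p.1) p.2 g].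
Proof. by have [s [f H]] := homog_span v; exists (s, f). Qed.

Definition gdecomp (v : V) : seq G * (G -> V) := projT1 (cid (gdecomp_ex v)).

(* [gcomp g v] is the component of degree g of v; it vanishes for g outside
   the finite sequence [gsupp v]. *)
Definition gsupp (v : V) : seq G := (gdecomp v).1.
Definition gcomp (g : G) (v : V) : V :=
  if g \in gsupp v then (gdecomp v).2 g else 0.

(* The linear extension of a family of maps [F g] given on the homogeneous
   elements of degree g. *)
Definition gext (W : lmodType k) (F : G -> V -> W) (v : V) : W :=
  \sum_(g <- gsupp v) F g (gcomp g v).

Lemma homogD g (u v : V) : homog V g u -> homog V g v -> homog V g (u + v).
Proof. by move=> hu hv; rewrite -[u]scale1r; apply: homogL. Qed.

Lemma homogZ g (c : k) (u : V) : homog V g u -> homog V g (c *: u).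
Proof. by move=> hu; rewrite -[_ *: u]addr0; apply: homogL => //; apply: homog0. Qed.

Lemma homogB g (u v : V) : homog V g u -> homog V g v -> homog V g (u - v).
Proof. by move=> hu hv; rewrite addrC -scaleN1r; apply: homogL. Qed.

Lemma homog_sum g (I : Type) (s : seq I) (P : pred I) (f : I -> V) :
  (forall i, P i -> homog V g (f i)) -> homog V g (\sum_(i <- s | P i) f i).
Proof.
by move=> h; elim/big_ind: _ => //; [apply: homog0 | move=> *; apply: homogD].
Qed.

Lemma gsupp_uniq v : uniq (gsupp v).
Proof. by rewrite /gsupp /gdecomp; case: cid => p []. Qed.

Lemma gcomp_homog g v : homog V g (gcomp g v).
Proof.
rewrite /gcomp; case: ifP => // _; last exact: homog0.
by rewrite /gdecomp; case: cid => p [].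
Qed.

Lemma gcompE v : v = \sum_(g <- gsupp v) gcomp g v.
Proof.
rewrite [LHS](_ : v = \sum_(g <- gsupp v) (gdecomp v).2 g); last first.
  by rewrite /gsupp /gdecomp; case: cid => p [].
by apply: eq_big_seq => g gs; rewrite /gcomp gs.
Qed.

Lemma gcomp_out g v : g \notin gsupp v -> gcomp g v = 0.
Proof. by rewrite /gcomp => /negPf ->. Qed.

Lemma big_uniq_ext (W : nmodType) (s t : seq G) (f : G -> W) :
  uniq s -> uniq t -> {subset s <= t} ->
  (forall g, g \notin s -> f g = 0) ->
  \sum_(g <- s) f g = \sum_(g <- t) f g.
Proof.
move=> us ut st f0; rewrite [RHS](bigID (mem s)) /= [X in _ + X]big1 ?addr0; last first.
  by move=> g; apply: f0.
rewrite -[RHS]big_filter; apply: perm_big; apply: uniq_perm => //.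
  by rewrite filter_uniq.
by move=> g; rewrite mem_filter; case: (boolP (g \in s)) => //= /st ->.
Qed.

Lemma gcomp_unique (s : seq G) (f : G -> V) v :
  uniq s -> (forall g, homog V g (f g)) -> (forall g, g \notin s -> f g = 0) ->
  v = \sum_(g <- s) f g -> forall g, gcomp g v = f g.
Proof.
move=> us hf f0 ev g.
pose t := undup (g :: s ++ gsupp v).
have ut : uniq t by apply: undup_uniq.
have sub1 : {subset s <= t}.
  by move=> x xs; rewrite mem_undup inE mem_cat xs /= orbT.
have sub2 : {subset gsupp v <= t}.
  by move=> x xs; rewrite mem_undup inE mem_cat xs /= !orbT.
have e : \sum_(h <- t) (gcomp h v - f h) = 0.
  rewrite sumrB -(big_uniq_ext us ut sub1 f0).
  rewrite -(big_uniq_ext (gsupp_uniq v) ut sub2) -?gcompE ?ev ?subrr //.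
  by move=> h; apply: gcomp_out.
apply/eqP; rewrite -subr_eq0; apply/eqP.
apply: (homog_indep ut _ e) => [h|]; last by rewrite mem_undup inE eqxx.
by apply: homogB => //; apply: gcomp_homog.
Qed.

Lemma gcomp_is_linear g : linear (gcomp g).
Proof.
move=> c u v.
pose t := undup (gsupp u ++ gsupp v).
have ut : uniq t by apply: undup_uniq.
apply: (@gcomp_unique t (fun g => c *: gcomp g u + gcomp g v)) => //.
- by move=> h; apply: homogL; apply: gcomp_homog.
- move=> h; rewrite mem_undup mem_cat negb_or => /andP[hu hv].
  by rewrite !gcomp_out // scaler0 addr0.
- rewrite big_split -scaler_sumr /=; congr (_ *: _ + _).
    rewrite {1}[u]gcompE; apply: big_uniq_ext => //; first exact: gsupp_uniq.
      by move=> h hs; rewrite mem_undup mem_cat hs.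
    by move=> h; apply: gcomp_out.
  rewrite {1}[v]gcompE; apply: big_uniq_ext => //; first exact: gsupp_uniq.
    by move=> h hs; rewrite mem_undup mem_cat hs orbT.
  by move=> h; apply: gcomp_out.
Qed.

HB.instance Definition _ g :=
  GRing.isLinear.Build k V V _ (gcomp g) (gcomp_is_linear g).

Lemma gcomp_homogE g h v : homog V g v -> gcomp h v = if h == g then v else 0.
Proof.
move=> hv; apply: (@gcomp_unique [:: g] (fun h => if h == g then v else 0)) => //.
- by move=> x; case: eqP => [->//|_]; apply: homog0.
- by move=> x; rewrite inE => /negPf ->.
- by rewrite big_seq1 eqxx.
Qed.

Lemma homog_ind (P : V -> Prop) :
  P 0 -> (forall u v, P u -> P v -> P (u + v)) ->
  (forall g v, homog V g v -> P v) -> forall v, P v.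
Proof.
move=> P0 PD Ph v; rewrite [v]gcompE; elim/big_ind: _ => // g _.
by apply: (Ph g); apply: gcomp_homog.
Qed.

Lemma homog_ext (W : lmodType k) (f1 f2 : V -> W) :
  linear f1 -> linear f2 ->
  (forall g v, homog V g v -> f1 v = f2 v) -> f1 =1 f2.
Proof.
move=> l1 l2 e.
pose L1 := GRing.isLinear.Build k V W _ f1 l1.
pose L2 := GRing.isLinear.Build k V W _ f2 l2.
pose g1 : {linear V -> W} := HB.pack f1 L1.
pose g2 : {linear V -> W} := HB.pack f2 L2.
move=> v; rewrite -[f1 v]/(g1 v) -[f2 v]/(g2 v).
elim/homog_ind: v => [|u v eu ev|g v /e //]; first by rewrite !linear0.
by rewrite !linearD eu ev.
Qed.

Lemma gext_widen (W : lmodType k) (F : G -> V -> W) (t : seq G) v :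
  (forall g, F g 0 = 0) -> uniq t -> {subset gsupp v <= t} ->
  gext F v = \sum_(g <- t) F g (gcomp g v).
Proof.
move=> F0 ut st; apply: big_uniq_ext => //; first exact: gsupp_uniq.
by move=> g /gcomp_out ->.
Qed.

Lemma linear_0 (U W : lmodType k) (f : U -> W) : linear f -> f 0 = 0.
Proof. by move=> l; have := l (-1) 0 0; rewrite scaleN1r oppr0 addr0 scaleN1r addNr. Qed.

Lemma gext_linear (W : lmodType k) (F : G -> V -> W) :
  (forall g, linear (F g)) -> linear (gext F).
Proof.
move=> lF c u v; have F0 g : F g 0 = 0 by apply: linear_0.
pose t := undup (gsupp u ++ gsupp v ++ gsupp (c *: u + v)).
have ut : uniq t by apply: undup_uniq.
rewrite !(@gext_widen _ F t) //; try by move=> h hs; rewrite mem_undup !mem_cat hs ?orbT.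
rewrite scaler_sumr -big_split /=; apply: eq_bigr => g _.
by rewrite linearP lF.
Qed.

Lemma gext_param (W U : lmodType k) (F : U -> G -> V -> W) v :
  (forall g x, linear (fun u => F u g x)) -> linear (fun u => gext (F u) v).
Proof.
move=> lF c u1 u2; rewrite /gext scaler_sumr -big_split /=.
by apply: eq_bigr => g _; rewrite lF.
Qed.

Lemma gextE (W : lmodType k) (F : G -> V -> W) g v :
  (forall g, F g 0 = 0) -> homog V g v -> gext F v = F g v.
Proof.
move=> F0 hv.
rewrite (@gext_widen _ F (undup (g :: gsupp v))) ?undup_uniq //; last first.
  by move=> h hs; rewrite mem_undup inE hs orbT.
rewrite (bigD1_seq g) ?undup_uniq ?mem_undup ?inE ?eqxx //=.
rewrite (gcomp_homogE g hv) eqxx big1 ?addr0 // => h /negPf hg.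
by rewrite (gcomp_homogE h hv) hg.
Qed.

End Components.

Section GVectBuild.
Variables (k : fieldType) (G : groupType) (V : lmodType k).
Variable hom : G -> V -> Prop.
Hypothesis hom0 : forall g, hom g 0.
Hypothesis homL : forall g (c : k) u v, hom g u -> hom g v -> hom g (c *: u + v).

Lemma span_of_list (l : seq (G * V)) :
  (forall p, p \in l -> hom p.1 p.2) -> exists (s : seq G) (f : G -> V),
    [/\ uniq s, forall g, hom g (f g) & \sum_(p <- l) p.2 = \sum_(g <- s) f g].
Proof.
move=> hl; exists (undup (unzip1 l)), (fun g => \sum_(p <- l | p.1 == g) p.2).
split; first exact: undup_uniq.
  move=> g; rewrite big_seq_cond; elim/big_ind: _ => //.
    by move=> u v hu hv; rewrite -[u]scale1r; apply: homL.
  by move=> p /andP[/hl hp /eqP <-].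
rewrite (exchange_big_dep xpredT) //= [LHS]big_seq [RHS]big_seq.
apply: eq_bigr => p pl; rewrite (eq_bigl (pred1 p.1)); last by move=> g; rewrite /= eq_sym.
have ps : p.1 \in undup (unzip1 l) by rewrite mem_undup; apply: map_f.
rewrite big_mkcond (bigD1_seq p.1) ?undup_uniq //= eqxx big1 ?addr0 //.
by move=> g /negPf ->.
Qed.

Lemma indep_of_proj (pr : G -> V -> V) : (forall g, linear (pr g)) ->
  (forall g h v, hom g v -> pr h v = if h == g then v else 0) ->
  forall (s : seq G) (f : G -> V), uniq s -> (forall g, hom g (f g)) ->
  \sum_(g <- s) f g = 0 -> forall g, g \in s -> f g = 0.
Proof.
move=> lpr prE s f us hf e g gs.
pose L1 := GRing.isLinear.Build k V V _ (pr g) (lpr g).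
pose g1 : {linear V -> V} := HB.pack (pr g) L1.
have := congr1 g1 e; rewrite linear0 linear_sum (bigD1_seq g) //=.
rewrite (prE g) // eqxx big1 ?addr0 // => h hg.
by rewrite (prE h) // eq_sym (negPf hg).
Qed.

End GVectBuild.

Section Tensor.
Variables (k : fieldType) (M N : lmodType k).
Variables (X : Type) (r : X -> M -> M) (l : X -> N -> N).

(* A list of pairs stands for the formal sum of the m ⊗ n. The tensor product
   [tens r l] is the quotient by the smallest congruence that makes ⊗ k-bilinear
   and identifies r x m ⊗ n with m ⊗ l x n, for a right action r on M and a left
   action l on N. *)
Inductive tens_eq : seq (M * N) -> seq (M * N) -> Prop :=
| tens_eq_refl s : tens_eq s s
| tens_eq_sym s t : tens_eq s t -> tens_eq t s
| tens_eq_trans s t u : tens_eq s t -> tens_eq t u -> tens_eq s u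
| tens_eq_catC s t : tens_eq (s ++ t) (t ++ s)
| tens_eq_cat s1 s2 t1 t2 :
    tens_eq s1 t1 -> tens_eq s2 t2 -> tens_eq (s1 ++ s2) (t1 ++ t2)
| tens_eq_scale (c : k) s t : tens_eq s t ->
    tens_eq [seq (c *: p.1, p.2) | p <- s] [seq (c *: p.1, p.2) | p <- t]
| tens_eq_0l n : tens_eq [:: (0, n)] [::]
| tens_eq_Dl m m' n : tens_eq [:: (m + m', n)] [:: (m, n); (m', n)]
| tens_eq_Dr m n n' : tens_eq [:: (m, n + n')] [:: (m, n); (m, n')]
| tens_eq_Z (c : k) m n : tens_eq [:: (c *: m, n)] [:: (m, c *: n)]
| tens_eq_bal x m n : tens_eq [:: (r x m, n)] [:: (m, l x n)].

Definition tens_eqb (s t : seq (M * N)) : bool := `[< tens_eq s t >].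

Fact tens_eqb_refl : reflexive tens_eqb.
Proof. by move=> s; apply/asboolP; apply: tens_eq_refl. Qed.
Fact tens_eqb_sym : symmetric tens_eqb.
Proof. by move=> s t; apply/asboolP/asboolP; apply: tens_eq_sym. Qed.
Fact tens_eqb_trans : transitive tens_eqb.
Proof.
by move=> s t u /asboolP h1 /asboolP h2; apply/asboolP; apply: tens_eq_trans h1 h2.
Qed.

Canonical tens_equiv := EquivRel tens_eqb tens_eqb_refl tens_eqb_sym tens_eqb_trans.

Definition tens := {eq_quot tens_equiv}.
HB.instance Definition _ := Choice.on tens.
HB.instance Definition _ := EqQuotient.on tens.

Definition tpure (m : M) (n : N) : tens := \pi_tens [:: (m, n)].

Lemma tens_piP (s t : seq (M * N)) : tens_eq s t <-> \pi_tens s = \pi_tens t.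
Proof.
split=> [h|]; first by apply/eqP; rewrite piE; apply/asboolP.
by move/eqP; rewrite piE => /asboolP.
Qed.

Lemma tens_repr (s : seq (M * N)) : tens_eq (repr (\pi_tens s)) s.
Proof. by apply/tens_piP; rewrite reprK. Qed.

Definition tens_zero : tens := \pi_tens [::].
Definition tens_add (x y : tens) : tens := \pi_tens (repr x ++ repr y).
Definition tens_scale (c : k) (x : tens) : tens :=
  \pi_tens [seq (c *: p.1, p.2) | p <- repr x].
Definition tens_opp (x : tens) : tens := tens_scale (-1) x.

Let addE s t : tens_add (\pi_tens s) (\pi_tens t) = \pi_tens (s ++ t).
Proof. by apply/tens_piP; apply: tens_eq_cat; apply: tens_repr. Qed.

Let scaleE c s :
  tens_scale c (\pi_tens s) = \pi_tens [seq (c *: p.1, p.2) | p <- s].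
Proof. by apply/tens_piP; apply: tens_eq_scale; apply: tens_repr. Qed.

Fact tens_addA : associative tens_add.
Proof.
move=> x y z; rewrite -(reprK x) -(reprK y) -(reprK z); move: (repr x) (repr y) (repr z) => s t u.
by rewrite (addE t u) (addE s t) (addE s) (addE (s ++ t)) catA.
Qed.
Fact tens_addC : commutative tens_add.
Proof.
move=> x y; rewrite -(reprK x) -(reprK y); move: (repr x) (repr y) => s t.
rewrite (addE s t) (addE t s); apply/tens_piP.
exact: tens_eq_catC.
Qed.
Fact tens_add0 : left_id tens_zero tens_add.
Proof. by move=> x; rewrite -(reprK x) addE. Qed.

HB.instance Definition _ := GRing.isNmodule.Build tens tens_addA tens_addC tens_add0.

Let eq_consl (p : M * N) s t : tens_eq s t -> tens_eq (p :: s) (p :: t).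
Proof.
by move=> h; apply: (@tens_eq_cat [:: p] s [:: p] t) => //; apply: tens_eq_refl.
Qed.

Let scale0 s : tens_eq [seq (0 *: p.1, p.2) | p <- s] [::].
Proof.
elim: s => [|[m n] s IHs] /=; first exact: tens_eq_refl.
rewrite scale0r; apply: (@tens_eq_cat [:: (0, n)] _ [::] [::]) => //.
exact: tens_eq_0l.
Qed.

Let scaleDl_eq (c d : k) s :
  tens_eq [seq ((c + d) *: p.1, p.2) | p <- s]
          ([seq (c *: p.1, p.2) | p <- s] ++ [seq (d *: p.1, p.2) | p <- s]).
Proof.
elim: s => [|[m n] s IHs] /=; first exact: tens_eq_refl.
rewrite scalerDl.
apply: (@tens_eq_trans _ ([:: (c *: m, n); (d *: m, n)] ++
  ([seq (c *: p.1, p.2) | p <- s] ++ [seq (d *: p.1, p.2) | p <- s]))).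
  apply: (@tens_eq_cat [:: _]) => //; exact: tens_eq_Dl.
apply: (eq_consl (c *: m, n)); set u := map _ s; set v := map _ s.
rewrite -[u ++ _ :: v]/(u ++ ([:: (d *: m, n)] ++ v)) catA.
apply: (@tens_eq_cat ([:: (d *: m, n)] ++ u)); last exact: tens_eq_refl.
exact: tens_eq_catC.
Qed.

Fact tens_addN : left_inverse tens_zero tens_opp tens_add.
Proof.
move=> x; rewrite -(reprK x); move: (repr x) => s; rewrite /tens_opp (scaleE _ s) (addE _ s); apply/tens_piP.
have -> : s = [seq (1 *: p.1, p.2) | p <- s].
  by rewrite -[LHS]map_id; apply: eq_map => -[m n]; rewrite scale1r.
rewrite -map_comp (@eq_map _ _ _ (fun p => (-1 *: p.1, p.2))); last first.
  by move=> p /=; rewrite scale1r.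
apply: tens_eq_trans (scale0 s); rewrite -(addNr 1).
by apply: tens_eq_sym; apply: scaleDl_eq.
Qed.

HB.instance Definition _ := GRing.Nmodule_isZmodule.Build tens tens_addN.

Fact tens_scaleA c d x : tens_scale c (tens_scale d x) = tens_scale (c * d) x.
Proof.
rewrite -(reprK x); move: (repr x) => s; rewrite (scaleE d s) (scaleE c) (scaleE _ s) -map_comp; congr (\pi _).
by apply: eq_map => p /=; rewrite scalerA.
Qed.
Fact tens_scale1 : left_id 1 tens_scale.
Proof.
move=> x; rewrite -(reprK x); move: (repr x) => s; rewrite scaleE -[in RHS](map_id s); congr (\pi _).
by apply: eq_map => -[m n]; rewrite scale1r.
Qed.
Fact tens_scaleDr : right_distributive tens_scale +%R.
Proof.
move=> c; move=> x y; rewrite -(reprK x) -(reprK y); move: (repr x) (repr y) => s t.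
by rewrite -[_ + _]/(tens_add _ _) -[RHS]/(tens_add _ _) (addE s t) (scaleE c s) (scaleE c t) (scaleE c (s ++ t)) addE map_cat.
Qed.
Fact tens_scaleDl x : {morph tens_scale^~ x : c d / c + d}.
Proof.
move=> c d; elim/quotW: x => s.
rewrite -[RHS]/(tens_add _ _) (scaleE _ s) (scaleE c s) (scaleE d s) addE.
apply/tens_piP; exact: scaleDl_eq.
Qed.

HB.instance Definition _ := GRing.Zmodule_isLmodule.Build k tens
  tens_scaleA tens_scale1 tens_scaleDr tens_scaleDl.

Lemma tpure_bilinear : bilinear_map tpure.
Proof.
have ZE c m n : c *: tpure m n = tpure (c *: m) n by rewrite -[LHS]/(tens_scale _ _) scaleE.
split=> [m c n n'|n c m m'].
  rewrite ZE -[RHS]/(tens_add _ _) addE; apply/tens_piP.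
  apply: tens_eq_trans (tens_eq_Dr _ _ _) _.
  apply: (@tens_eq_cat [:: _] [:: _] [:: _] [:: _]); last exact: tens_eq_refl.
  apply: tens_eq_sym; exact: tens_eq_Z.
rewrite ZE -[RHS]/(tens_add _ _) addE; apply/tens_piP; exact: tens_eq_Dl.
Qed.

Lemma tpure_balanced x m n : tpure (r x m) n = tpure m (l x n).
Proof. apply/tens_piP; exact: tens_eq_bal. Qed.

Lemma tens_sumE (s : seq (M * N)) : \pi_tens s = \sum_(p <- s) tpure p.1 p.2.
Proof.
elim: s => [|[m n] s IHs]; first by rewrite big_nil.
by rewrite big_cons -IHs -[RHS]/(tens_add _ _) addE.
Qed.

Lemma tens_ind (P : tens -> Prop) :
  P 0 -> (forall x y, P x -> P y -> P (x + y)) -> (forall m n, P (tpure m n)) ->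
  forall x, P x.
Proof.
move=> P0 PD Pp; move=> x; rewrite -(reprK x); move: (repr x) => s; rewrite tens_sumE.
by elim/big_ind: _ => // p _.
Qed.

Lemma tens_ext (W : lmodType k) (f g : tens -> W) :
  linear f -> linear g -> (forall m n, f (tpure m n) = g (tpure m n)) -> f =1 g.
Proof.
move=> lf lg e.
have D (h : tens -> W) : linear h -> forall x y, h (x + y) = h x + h y.
  by move=> lh x y; have := lh 1 x y; rewrite !scale1r.
elim/tens_ind => // [|x y ex ey]; first by rewrite !linear_0.
by rewrite !D // ex ey.
Qed.

(* The linear map m ⊗ n |-> f m n; it does not depend on the representative
   when f is bilinear and balanced, see [tliftE]. *)
Definition tlift (W : lmodType k) (f : M -> N -> W) (x : tens) : W :=
  \sum_(p <- repr x) f p.1 p.2.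

Definition balanced (W : Type) (f : M -> N -> W) :=
  forall x m n, f (r x m) n = f m (l x n).

Section Lift.
Variables (W : lmodType k) (f : M -> N -> W).
Hypotheses (bf : bilinear_map f) (baf : balanced f).

Let fDl m m' n : f (m + m') n = f m n + f m' n.
Proof. by have := bf.2 n 1 m m'; rewrite !scale1r. Qed.
Let fDr m n n' : f m (n + n') = f m n + f m n'.
Proof. by have := bf.1 m 1 n n'; rewrite !scale1r. Qed.
Let f0l n : f 0 n = 0. Proof. exact: (linear_0 (bf.2 n)). Qed.
Let f0r m : f m 0 = 0. Proof. exact: (linear_0 (bf.1 m)). Qed.
Let fZl c m n : f (c *: m) n = c *: f m n.
Proof. by have := bf.2 n c m 0; rewrite f0l !addr0. Qed.
Let fZr c m n : f m (c *: n) = c *: f m n.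
Proof. by have := bf.1 m c n 0; rewrite f0r !addr0. Qed.

Let lift_eq s t : tens_eq s t ->
  \sum_(p <- s) f p.1 p.2 = \sum_(p <- t) f p.1 p.2.
Proof.
elim=> {s t} //=.
- by move=> s t u _ -> _ ->.
- by move=> s t; rewrite !big_cat /= addrC.
- by move=> s1 s2 t1 t2 _ e1 _ e2; rewrite !big_cat /= e1 e2.
- move=> c s t _ e; rewrite !big_map /=.
  transitivity (c *: \sum_(p <- s) f p.1 p.2).
    by rewrite scaler_sumr; apply: eq_bigr => p _; rewrite fZl.
  by rewrite e scaler_sumr; apply: eq_bigr => p _; rewrite fZl.
- by move=> n; rewrite big_seq1 big_nil f0l.
- by move=> m m' n; rewrite !big_cons big_nil !addr0 fDl.
- by move=> m n n'; rewrite !big_cons big_nil !addr0 fDr.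
- by move=> c m n; rewrite !big_seq1 /= fZl fZr.
- by move=> x m n; rewrite !big_seq1 /=; apply: baf.
Qed.

Let liftE s : tlift f (\pi_tens s) = \sum_(p <- s) f p.1 p.2.
Proof. by apply: lift_eq; apply: tens_repr. Qed.

Lemma tliftE m n : tlift f (tpure m n) = f m n.
Proof. by rewrite liftE big_seq1. Qed.

Lemma tlift_linear : linear (tlift f).
Proof.
move=> c; move=> x y; rewrite -(reprK x) -(reprK y); move: (repr x) (repr y) => s t.
rewrite -[c *: _]/(tens_scale _ _) -[_ + _]/(tens_add _ _) (scaleE c s) addE !liftE.
rewrite big_cat big_map scaler_sumr /=; congr (_ + _).
by apply: eq_bigr => p _; rewrite fZl.
Qed.

End Lift.

Lemma tlift_param (W U : lmodType k) (F : U -> M -> N -> W) (x : tens) :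
  (forall m n, linear (fun u => F u m n)) -> linear (fun u => tlift (F u) x).
Proof.
move=> h c u v; rewrite /tlift scaler_sumr -big_split /=.
by apply: eq_bigr => p _; rewrite h.
Qed.

Lemma eq_tlift (W : lmodType k) (f g : M -> N -> W) :
  f =2 g -> tlift f =1 tlift g.
Proof. by move=> e x; apply: eq_bigr => p _; apply: e. Qed.

End Tensor.

Arguments tens_ind {k M N X r l} P.
Arguments tpure {k M N X r l} m n.

Lemma graded_gcomp (k : fieldType) (G : groupType) (V W : gvect k G) (f : V -> W) :
  linear f -> graded_map f -> forall g v, gcomp g (f v) = f (gcomp g v).
Proof.
move=> lf hf g; have f0 := linear_0 lf; apply: homog_ext.
- by move=> c u v; rewrite lf linearP.
- by move=> c u v; rewrite linearP lf.
- move=> h v hv; rewrite (gcomp_homogE g (hf _ _ hv)) (gcomp_homogE g hv).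
  by case: ifP.
Qed.

Section GradedTensor.
Variables (k : fieldType) (G : groupType) (M N : gvect k G).
Variables (X : Type) (r : X -> M -> M) (l : X -> N -> N).

Definition tens_homog (g : G) (t : tens r l) : Prop :=
  exists s : seq (M * N), t = \sum_(p <- s) tpure p.1 p.2 /\
    forall p, p \in s -> exists g' g'', [/\ (g' * g'')%g = g,
      homog M g' p.1 & homog N g'' p.2].

(* The component of degree g of m ⊗ n; it has to be balanced for the tensor
   product to be graded. *)
Definition tens_proj (g : G) (m : M) (n : N) : tens r l :=
  gext (fun h mh => tpure mh (gcomp (h^-1 * g)%g n)) m.

Lemma tens_homog0 g : tens_homog g 0.
Proof. by exists [::]; rewrite big_nil; split. Qed.

Lemma tens_homogL g (c : k) u v :
  tens_homog g u -> tens_homog g v -> tens_homog g (c *: u + v).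
Proof.
move=> [s [-> hs]] [t [-> ht]].
exists ([seq (c *: p.1, p.2) | p <- s] ++ t); split.
  rewrite big_cat big_map scaler_sumr /=; congr (_ + _).
  apply: eq_bigr => p _ /=.
  by have := (tpure_bilinear r l).2 p.2 c p.1 0; rewrite !(linear_0 ((tpure_bilinear r l).2 _)) !addr0.
move=> p; rewrite mem_cat => /orP[/mapP[q qs ->]|/ht //].
have [g' [g'' [e h1 h2]]] := hs _ qs; exists g', g''; split=> //=.
exact: homogZ.
Qed.

Lemma tens_homog_pure g g' m n :
  homog M g m -> homog N g' n -> tens_homog (g * g')%g (tpure m n).
Proof.
move=> hm hn; exists [:: (m, n)]; rewrite big_seq1; split=> // p.
by rewrite inE => /eqP ->; exists g, g'.
Qed.

Lemma tens_span t : exists (s : seq G) (f : G -> tens r l),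
  [/\ uniq s, forall g, tens_homog g (f g) & t = \sum_(g <- s) f g].
Proof.
suff [w [hw ->]] : exists w : seq (G * tens r l),
    (forall p, p \in w -> tens_homog p.1 p.2) /\ t = \sum_(p <- w) p.2.
  exact: span_of_list tens_homog0 tens_homogL _ hw.
elim/(@tens_ind k M N X r l): t => [|x y [wx [hx ->]] [wy [hy ->]]|m n].
- by exists [::]; rewrite big_nil.
- exists (wx ++ wy); rewrite big_cat; split=> // p.
  by rewrite mem_cat => /orP[/hx|/hy].
exists [seq ((p.1 * p.2)%g, tpure (gcomp p.1 m) (gcomp p.2 n)) |
         p <- [seq (g, h) | g <- gsupp m, h <- gsupp n]]; split.
  by move=> p /mapP[q _ ->]; apply: tens_homog_pure; apply: gcomp_homog.
rewrite big_map big_allpairs /= {1}[m]gcompE.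
have lin_sum (W : lmodType k) (f : W -> tens r l) (F : G -> W) s : linear f ->
    f (\sum_(g <- s) F g) = \sum_(g <- s) f (F g).
  move=> lf; elim: s => [|g s IHs]; first by rewrite !big_nil linear_0.
  rewrite !big_cons -IHs; have := lf 1 (F g) (\sum_(g <- s) F g).
  by rewrite !scale1r.
rewrite (lin_sum _ (tpure^~ n)); last exact: (tpure_bilinear r l).2.
apply: eq_bigr => g _; rewrite {1}[n]gcompE lin_sum //.
exact: (tpure_bilinear r l).1.
Qed.

Lemma tens_proj_bilinear g : bilinear_map (tens_proj g).
Proof.
have [l1 l2] := tpure_bilinear r l.
split=> [m c u v|n].
  rewrite /tens_proj /gext scaler_sumr -big_split /=; apply: eq_bigr => h _.
  by rewrite linearP l1.
by apply: gext_linear => h c u v; rewrite l2.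
Qed.

Hypothesis tens_projP : forall g, balanced r l (tens_proj g).

Lemma tens_indep (s : seq G) (f : G -> tens r l) :
  uniq s -> (forall g, tens_homog g (f g)) -> \sum_(g <- s) f g = 0 ->
  forall g, g \in s -> f g = 0.
Proof.
pose pr g := tlift (r := r) (l := l) (tens_proj g).
have lpr g : linear (pr g) := tlift_linear (tens_proj_bilinear g) (tens_projP g).
apply: (indep_of_proj (pr := pr)) => // g h v [w [-> hw]].
have prD x y : pr h (x + y) = pr h x + pr h y.
  by have := lpr h 1 x y; rewrite !scale1r.
elim: w hw => [|p w IHw] hw.
  by rewrite !big_nil (linear_0 (lpr h)); case: ifP.
rewrite !big_cons prD IHw; last by move=> q qw; apply: hw; rewrite inE qw orbT.
have [g' [g'' [e h1 h2]]] := hw p (mem_head _ _).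
rewrite /pr tliftE //; last exact: tens_proj_bilinear.
rewrite /tens_proj (gextE _ h1); last first.
  by move=> i; exact: (linear_0 ((tpure_bilinear r l).2 _)).
rewrite (gcomp_homogE _ h2) -e.
have -> : (g'^-1 * h == g'')%g = (h == g' * g'')%g.
  by rewrite -(inj_eq (mulgI g') _ g'') mulVKg.
case: ifP => // _; rewrite (linear_0 ((tpure_bilinear r l).1 _)) ?addr0 //.
Qed.

Definition tensG : gvect k G :=
  GVect tens_homog0 tens_homogL tens_span tens_indep.

End GradedTensor.

Section GroundTensor.
Variables (k : fieldType) (G : groupType).

(* The tensor product over k: there are no balancing relations besides
   k-bilinearity, hence the empty type of scalars. *)
Definition tensk (M N : gvect k G) : gvect k G :=
  @tensG k G M N void (of_void _) (of_void _) (fun _ x => of_void _ x).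

Definition tk (M N : gvect k G) (m : M) (n : N) : tensk M N :=
  @tpure k M N void (of_void _) (of_void _) m n.

Definition klift (M N : gvect k G) (W : lmodType k) (f : M -> N -> W)
    (x : tensk M N) : W :=
  @tlift k M N void (of_void _) (of_void _) W f x.

End GroundTensor.

Notation "M ⊗ N" := (tensk M N) (at level 40, left associativity) : gvect_scope.
Notation "M ⊗ N" := (gv_sort (tensk M N)) (only parsing) : type_scope.
Notation "m ⊗ n" := (tk m n) (at level 40, left associativity) : ring_scope.

Section GroundTensorTheory.
Variables (k : fieldType) (G : groupType).
Implicit Types M N : gvect k G.

Lemma tk_bilinear M N : bilinear_map (@tk k G M N).
Proof. exact: tpure_bilinear. Qed.

Lemma kliftE M N (W : lmodType k) (f : M -> N -> W) m n :
  bilinear_map f -> klift f (m ⊗ n) = f m n.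
Proof. by move=> bf; apply: tliftE. Qed.

Lemma klift_linear M N (W : lmodType k) (f : M -> N -> W) :
  bilinear_map f -> linear (klift f).
Proof. by move=> bf; apply: tlift_linear. Qed.

Lemma tensk_ind M N (P : (M ⊗ N)%type -> Prop) :
  P 0 -> (forall x y, P x -> P y -> P (x + y)) -> (forall m n, P (m ⊗ n)) ->
  forall x, P x.
Proof. exact: tens_ind. Qed.

Lemma tensk_ext M N (W : lmodType k) (f g : (M ⊗ N)%type -> W) :
  linear f -> linear g -> (forall m n, f (m ⊗ n) = g (m ⊗ n)) -> f =1 g.
Proof. exact: tens_ext. Qed.

Lemma klift_param M N (W U : lmodType k) (F : U -> M -> N -> W) x :
  (forall m n, linear (fun u => F u m n)) -> linear (fun u => klift (F u) x).
Proof. exact: tlift_param. Qed.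

Lemma eq_klift M N (W : lmodType k) (f g : M -> N -> W) :
  f =2 g -> klift f =1 klift g.
Proof. exact: eq_tlift. Qed.

Lemma tk_homog M N g g' m n :
  homog M g m -> homog N g' n -> homog (M ⊗ N) (g * g')%g (m ⊗ n).
Proof. exact: tens_homog_pure. Qed.

(* A linear map is graded as soon as it is so on the homogeneous pure tensors. *)
Lemma klift_graded M N (W : gvect k G) (f : M -> N -> W) : bilinear_map f ->
  (forall g g' m n, homog M g m -> homog N g' n -> homog W (g * g')%g (f m n)) ->
  graded_map (klift f).
Proof.
move=> bf hf g _ [s [-> hs]]; have lf := klift_linear bf.
elim: s hs => [|p s IHs] hs; first by rewrite big_nil linear_0 //; apply: homog0.
rewrite big_cons.
have -> x y : klift f (x + y) = klift f x + klift f y.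
  by have := lf 1 x y; rewrite !scale1r.
apply: homogD; last by apply: IHs => q qs; apply: hs; rewrite inE qs orbT.
have [g' [g'' [<- h1 h2]]] := hs p (mem_head _ _).
by rewrite (kliftE p.1 p.2 bf); apply: hf.
Qed.

End GroundTensorTheory.

Section GroundTensorMaps.
Variables (k : fieldType) (G : groupType).

Definition tmap (M N M' N' : gvect k G) (f : M -> M') (g : N -> N')
    (x : M ⊗ N) : M' ⊗ N' :=
  klift (fun m n => f m ⊗ g n) x.

Definition tassoc (U V W : gvect k G) (x : U ⊗ V ⊗ W) : U ⊗ (V ⊗ W) :=
  klift (fun y w => klift (fun u v => u ⊗ (v ⊗ w)) y) x.

Lemma lin_comp (U V W : lmodType k) (f : V -> W) (g : U -> V) :
  linear f -> linear g -> linear (fun x => f (g x)).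
Proof. by move=> lf lg c u v; rewrite lg lf. Qed.

Lemma lin_id (U : lmodType k) : linear (@id U).
Proof. by []. Qed.

Lemma tmap_bilinear (M N M' N' : gvect k G) (f : M -> M') (g : N -> N') :
  linear f -> linear g -> bilinear_map (fun m n => f m ⊗ g n).
Proof.
move=> lf lg; split=> [m|n].
  by apply: (lin_comp ((tk_bilinear M' N').1 (f m)) lg).
by apply: (lin_comp ((tk_bilinear M' N').2 (g n)) lf).
Qed.

Lemma tmapE (M N M' N' : gvect k G) (f : M -> M') (g : N -> N') m n :
  linear f -> linear g -> tmap f g (m ⊗ n) = f m ⊗ g n.
Proof. by move=> lf lg; apply: kliftE; apply: tmap_bilinear. Qed.

Lemma tmap_linear (M N M' N' : gvect k G) (f : M -> M') (g : N -> N') :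
  linear f -> linear g -> linear (tmap f g).
Proof. by move=> lf lg; apply: klift_linear; apply: tmap_bilinear. Qed.

Let tassoc1 (U V W : gvect k G) (w : W) :
  bilinear_map (fun (u : U) (v : V) => u ⊗ (v ⊗ w)).
Proof.
split=> [u|v]; last exact: (tk_bilinear _ _).2.
exact: (lin_comp ((tk_bilinear U (V ⊗ W)).1 u) ((tk_bilinear V W).2 w)).
Qed.

Let tassoc2 (U V W : gvect k G) :
  bilinear_map (fun (y : (U ⊗ V)%type) (w : W) => klift (fun u v => u ⊗ (v ⊗ w)) y).
Proof.
split=> [y|w]; last exact: klift_linear (tassoc1 _ _ w).
apply: (klift_param (F := fun w u v => u ⊗ (v ⊗ w))) => u v.
exact: (lin_comp ((tk_bilinear U (V ⊗ W)).1 u) ((tk_bilinear V W).1 v)).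
Qed.

Lemma tassoc_linear (U V W : gvect k G) : linear (@tassoc U V W).
Proof. exact: klift_linear (tassoc2 U V W). Qed.

Lemma tassocE (U V W : gvect k G) (u : U) (v : V) (w : W) :
  tassoc (u ⊗ v ⊗ w) = u ⊗ (v ⊗ w).
Proof.
rewrite /tassoc (kliftE (u ⊗ v) w (tassoc2 U V W)).
exact: kliftE u v (tassoc1 U V w).
Qed.

Definition ground_homog (g : G) (c : k^o) : Prop := g = 1%g \/ c = 0.

Lemma ground_homog0 g : ground_homog g 0. Proof. by right. Qed.

Lemma ground_homogL g (c : k) u v :
  ground_homog g u -> ground_homog g v -> ground_homog g (c *: u + v).
Proof.
by move=> [->|->]; [left|move=> [->|->]; [left|right; rewrite scaler0 addr0]].
Qed.

Lemma ground_span (v : k^o) : exists (s : seq G) (f : G -> k^o),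
  [/\ uniq s, forall g, ground_homog g (f g) & v = \sum_(g <- s) f g].
Proof.
exists [:: 1%g], (fun g => if g == 1%g then v else 0); split=> //.
  by move=> g; case: eqP => [->|_]; [left|right].
by rewrite big_seq1 eqxx.
Qed.

Lemma ground_indep (s : seq G) (f : G -> k^o) :
  uniq s -> (forall g, ground_homog g (f g)) -> \sum_(g <- s) f g = 0 ->
  forall g, g \in s -> f g = 0.
Proof.
apply: (indep_of_proj (pr := fun g (c : k^o) => if g == 1%g then c else 0)).
  by move=> g c u v; case: eqP; rewrite ?scaler0 ?addr0.
by move=> g h v [->|->] //; case: ifP; case: ifP.
Qed.

Definition ground : gvect k G :=
  GVect ground_homog0 ground_homogL ground_span ground_indep.

End GroundTensorMaps.

(* Not built on [algType], whose elements are nonzero rings: A and B may be 0. *)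
Record colourAlg (k : fieldType) (G : groupType) := ColourAlg {
  ca_gvect :> gvect k G;
  ca_one : ca_gvect;
  ca_mul : ca_gvect -> ca_gvect -> ca_gvect;
  ca_mul_bilinear : bilinear_map ca_mul;
  ca_mulA : associative ca_mul;
  ca_mul1l : left_id ca_one ca_mul;
  ca_mul1r : right_id ca_one ca_mul;
  ca_one_homog : homog ca_gvect 1%g ca_one;
  ca_mul_homog : forall g g' a a', homog ca_gvect g a -> homog ca_gvect g' a' ->
    homog ca_gvect (g * g')%g (ca_mul a a') }.

Arguments ca_one {k G} c.
Arguments ca_mul {k G c} a b : rename.
Notation "a ∙ b" := (ca_mul a b) (at level 39, left associativity) : ring_scope.

Definition is_gmodule (k : fieldType) (G : groupType) (R : colourAlg k G)
    (M : gvect k G) (act : R -> M -> M) : Prop :=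
  [/\ bilinear_map act,
      forall a b m, act (a ∙ b) m = act a (act b m),
      forall m, act (ca_one R) m = m &
      forall g g' a m, homog R g a -> homog M g' m ->
        homog M (g * g')%g (act a m)].

Record gmod (k : fieldType) (G : groupType) (R : colourAlg k G) := GMod {
  gm_gvect :> gvect k G;
  gm_act : R -> gm_gvect -> gm_gvect;
  gm_module : is_gmodule gm_act }.

Arguments gm_act {k G R} M a m : rename.

Record bichar (k : fieldType) (G : groupType) := Bichar {
  bichar_fun :> G -> G -> k;
  bichar_neq0 : forall g g', bichar_fun g g' != 0;
  bicharMr : forall g g' g'',
    bichar_fun g (g' * g'')%g = bichar_fun g g' * bichar_fun g g'';
  bicharMl : forall g g' g'',
    bichar_fun (g * g')%g g'' = bichar_fun g g'' * bichar_fun g' g'' }.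

Section Structures.
Variables (k : fieldType) (G : groupType) (b : bichar k G).

(* The k-bilinear map (h ⊗ u, h' ⊗ v) |-> (|u| / |h'|) hh' ⊗ act u v, for u and h'
   homogeneous; see [bmulE]. *)
Definition bmul (H : colourAlg k G) (U V W : gvect k G) (act : U -> V -> W)
    (x : (H ⊗ U)%type) (y : (H ⊗ V)%type) : (H ⊗ W)%type :=
  klift (fun h u => klift (fun h' v =>
    gext (fun g ug => gext (fun g' hg' => b g g' *: ((h ∙ hg') ⊗ act ug v)) h') u)
    y) x.

Record colourHopf := ColourHopf {
  ch_alg :> colourAlg k G;
  comul : {linear ch_alg -> (ch_alg ⊗ ch_alg)%type};
  counit : {linear ch_alg -> k^o};
  antipode : {linear ch_alg -> ch_alg};
  comul_graded : graded_map (W := (ch_alg ⊗ ch_alg)%type) comul;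
  counit_graded : graded_map (W := ground k G) counit;
  antipode_graded : graded_map antipode;
  comulA : forall h,
    tassoc (tmap (M' := (ch_alg ⊗ ch_alg)%type) comul id (comul h)) =
    tmap (N' := (ch_alg ⊗ ch_alg)%type) id comul (comul h);
  comul_counitl : forall h, klift (fun h1 h2 => counit h1 *: h2) (comul h) = h;
  comul_counitr : forall h, klift (fun h1 h2 => counit h2 *: h1) (comul h) = h;
  counit1 : counit (ca_one ch_alg) = 1;
  counitM : forall h h', counit (h ∙ h') = counit h * counit h' :> k;
  comul1 : comul (ca_one ch_alg) = ca_one ch_alg ⊗ ca_one ch_alg;
  comulM : forall h h', comul (h ∙ h') = bmul (@ca_mul k G ch_alg) (comul h) (comul h');
  antipoder : forall h,
    klift (fun h1 h2 => h1 ∙ antipode h2) (comul h) = counit h *: ca_one ch_alg;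
  antipodel : forall h,
    klift (fun h1 h2 => antipode h1 ∙ h2) (comul h) = counit h *: ca_one ch_alg }.

Arguments comul {c}.
Arguments counit {c}.

Definition is_coaction (H : colourHopf) (M : gvect k G)
    (chi : M -> (H ⊗ M)%type) : Prop :=
  [/\ graded_map (W := (H ⊗ M)%type) chi,
      forall m, tassoc (tmap (M' := (H ⊗ H)%type) comul id (chi m)) =
                tmap (N' := (H ⊗ M)%type) id chi (chi m) &
      forall m, klift (fun h m' => counit h *: m') (chi m) = m].

Record comodule (H : colourHopf) := Comodule {
  cm_gvect :> gvect k G;
  coact : {linear cm_gvect -> (H ⊗ cm_gvect)%type};
  coactP : is_coaction coact }.

Record comodAlg (H : colourHopf) := ComodAlg {
  cma_alg :> colourAlg k G;
  cma_coact : {linear cma_alg -> (H ⊗ cma_alg)%type};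
  cma_coactP : is_coaction cma_coact;
  cma_coact1 : cma_coact (ca_one cma_alg) = ca_one H ⊗ ca_one cma_alg;
  cma_coactM : forall a a', cma_coact (a ∙ a') =
    bmul (@ca_mul k G cma_alg) (cma_coact a) (cma_coact a') }.

Definition alg_comodule (H : colourHopf) (A : comodAlg H) : comodule H :=
  Comodule (cma_coactP A).

Arguments coact {H c}.
Arguments cma_coact {H c}.

Record hopfMod (H : colourHopf) (A : comodAlg H) := HopfMod {
  hm_comodule :> comodule H;
  hm_act : A -> hm_comodule -> hm_comodule;
  hm_module : is_gmodule hm_act;
  hm_coactM : forall a m, coact (hm_act a m) =
    bmul hm_act (cma_coact a) (coact m) }.

End Structures.

Arguments comul {k G b c}.
Arguments counit {k G b c}.
Arguments antipode {k G b c}.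
Arguments coact {k G b H M} : rename.
Arguments cma_coact {k G b H A} : rename.
Arguments hm_act {k G b H A} M a m : rename.

Section BraidedProduct.
Variables (k : fieldType) (G : groupType) (b : bichar k G).
Variables (H : colourAlg k G) (U V W : gvect k G) (act : U -> V -> W).
Hypothesis act_bil : bilinear_map act.

Let tkl (M N : gvect k G) (n : N) : linear (fun m : M => m ⊗ n).
Proof. exact: (tk_bilinear M N).2. Qed.
Let tkr (M N : gvect k G) (m : M) : linear (fun n : N => m ⊗ n).
Proof. exact: (tk_bilinear M N).1. Qed.

Let bm h u h' v : (H ⊗ W)%type :=
  gext (fun g ug => gext (fun g' hg' => b g g' *: ((h ∙ hg') ⊗ act ug v)) h') u.

Let bm_h u h' v : linear (fun h => bm h u h' v).
Proof.
apply: (gext_param (F := fun h g ug => gext _ h')) => g ug.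
apply: (gext_param (F := fun h g' hg' => b g g' *: ((h ∙ hg') ⊗ act ug v))) => g' hg'.
by move=> c x y; rewrite (ca_mul_bilinear H).2 tkl scalerDr !scalerA mulrC.
Qed.

Let bm_v h u h' : linear (fun v => bm h u h' v).
Proof.
apply: (gext_param (F := fun v g ug => gext _ h')) => g ug.
apply: (gext_param (F := fun v g' hg' => b g g' *: ((h ∙ hg') ⊗ act ug v))) => g' hg'.
by move=> c x y; rewrite act_bil.1 tkr scalerDr !scalerA mulrC.
Qed.

Let bm_h' h u v : linear (fun h' => bm h u h' v).
Proof.
apply: (gext_param (F := fun h' g ug => gext _ h')) => g ug.
apply: gext_linear => g' c x y.
by rewrite (ca_mul_bilinear H).1 tkl scalerDr !scalerA mulrC.
Qed.

Let bm_u h h' v : linear (fun u => bm h u h' v).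
Proof.
apply: gext_linear => g.
apply: (gext_param (F := fun ug g' hg' => b g g' *: ((h ∙ hg') ⊗ act ug v))) => g' hg'.
by move=> c x y; rewrite act_bil.2 tkr scalerDr !scalerA mulrC.
Qed.

Let bm1 h u : bilinear_map (fun h' v => bm h u h' v).
Proof. by split=> *; [apply: bm_v|apply: bm_h']. Qed.

Let bm2 y : bilinear_map (fun h u => klift (fun h' v => bm h u h' v) y).
Proof.
split=> [h|u].
  by apply: (klift_param (F := fun u h' v => bm h u h' v)) => h' v; apply: bm_u.
by apply: (klift_param (F := fun h h' v => bm h u h' v)) => h' v; apply: bm_h.
Qed.

Lemma bmul_linearl (y : (H ⊗ V)%type) : linear (fun x : (H ⊗ U)%type => bmul b act x y).
Proof. exact: (klift_linear (bm2 y)). Qed.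

Lemma bmul_linearr (x : (H ⊗ U)%type) : linear (fun y : (H ⊗ V)%type => bmul b act x y).
Proof.
apply: (klift_param (F := fun y h u => klift (fun h' v => bm h u h' v) y)) => h u.
exact: klift_linear (bm1 h u).
Qed.

Lemma bmulE h u h' v g g' : homog U g u -> homog H g' h' ->
  bmul b act (h ⊗ u) (h' ⊗ v) = b g g' *: ((h ∙ h') ⊗ act u v).
Proof.
move=> hu hh'; rewrite /bmul (kliftE _ _ (bm2 _)) (kliftE _ _ (bm1 _ _)) /bm.
have lg' i ug : forall g0, b i g0 *: ((h ∙ 0) ⊗ act ug v) = 0.
  move=> j; rewrite (linear_0 ((ca_mul_bilinear H).1 h)).
  by rewrite (linear_0 (@tkl _ _ _)) scaler0.
rewrite (gextE _ hu) ?(gextE _ hh') //.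
move=> i; rewrite /gext big1 // => j _.
by rewrite (linear_0 (act_bil.2 v)) (linear_0 (@tkr _ _ _)) scaler0.
Qed.

Lemma bichar1r g : b g 1%g = 1.
Proof.
by apply: (mulfI (bichar_neq0 b g 1%g)); rewrite -bicharMr mulr1 mulg1.
Qed.

Lemma bmul1 h u v : bmul b act (h ⊗ u) (ca_one H ⊗ v) = h ⊗ act u v.
Proof.
elim/homog_ind: u => [|u1 u2 e1 e2|g u hu].
- by rewrite (linear_0 (act_bil.2 v)) !(linear_0 (@tkr _ _ _)) (linear_0 (bmul_linearl _)).
- have D (M : gvect k G) (m1 m2 : M) : h ⊗ (m1 + m2) = h ⊗ m1 + h ⊗ m2.
    by have := @tkr _ _ h 1 m1 m2; rewrite !scale1r.
  have := act_bil.2 v 1 u1 u2; rewrite !scale1r !D => ->.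
  have := @bmul_linearl (ca_one H ⊗ v) 1 (h ⊗ u1) (h ⊗ u2).
  by rewrite !scale1r D e1 e2.
- by rewrite (bmulE _ _ hu (ca_one_homog H)) bichar1r scale1r ca_mul1r.
Qed.

End BraidedProduct.

Section Coinvariants.
Variables (k : fieldType) (G : groupType) (b : bichar k G).
Variables (H : colourHopf b) (M : comodule H).

Definition coinv_pred : {pred M} := fun m => `[< coact m = ca_one H ⊗ m >].

Lemma coinvP m : reflect (coact m = ca_one H ⊗ m) (m \in coinv_pred).
Proof. exact: asboolP. Qed.

Fact coinv_submod : submod_closed coinv_pred.
Proof.
have l1 := (tk_bilinear H M).1 (ca_one H).
split=> [|c u v /coinvP eu /coinvP ev]; apply/coinvP.
  by rewrite linear0 (linear_0 l1).
by rewrite linearP eu ev l1.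
Qed.

HB.instance Definition _ := GRing.isSubmodClosed.Build k M coinv_pred coinv_submod.

Definition coinv_sort := {m : M | m \in coinv_pred}.
HB.instance Definition _ := SubChoice.on coinv_sort.
HB.instance Definition _ := [SubChoice_isSubLmodule of coinv_sort by <:].

Definition coinv_mk m (h : m \in coinv_pred) : coinv_sort :=
  exist (fun m => m \in coinv_pred) m h.

Lemma coinv_val (x : coinv_sort) : coact (val x) = ca_one H ⊗ val x.
Proof. by apply/coinvP; apply: valP. Qed.

Lemma coinv_gcomp g m : m \in coinv_pred -> gcomp g m \in coinv_pred.
Proof.
move/coinvP=> em; apply/coinvP.
have [cg _ _] := coactP M.
rewrite -(graded_gcomp (W := (H ⊗ M)%type) (linearP _) cg) em.
apply: (graded_gcomp (W := (H ⊗ M)%type) (f := fun m => ca_one H ⊗ m)).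
  exact: (tk_bilinear H M).1.
move=> h v hv; rewrite -[h]mul1g; apply: tk_homog hv; exact: ca_one_homog.
Qed.

Definition coinv_homog (g : G) (x : coinv_sort) : Prop := homog M g (val x).

Lemma coinv_homog0 g : coinv_homog g 0. Proof. exact: homog0. Qed.

Lemma coinv_homogL g (c : k) u v :
  coinv_homog g u -> coinv_homog g v -> coinv_homog g (c *: u + v).
Proof. exact: homogL. Qed.

Lemma coinv_span (x : coinv_sort) : exists (s : seq G) (f : G -> coinv_sort),
  [/\ uniq s, forall g, coinv_homog g (f g) & x = \sum_(g <- s) f g].
Proof.
exists (gsupp (val x)), (fun g => coinv_mk (coinv_gcomp g (valP x))).
split; first exact: gsupp_uniq.
  by move=> g; apply: gcomp_homog.
by apply: val_inj; rewrite raddf_sum; apply: gcompE.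
Qed.

Lemma coinv_indep (s : seq G) (f : G -> coinv_sort) :
  uniq s -> (forall g, coinv_homog g (f g)) -> \sum_(g <- s) f g = 0 ->
  forall g, g \in s -> f g = 0.
Proof.
move=> us hf e g gs; apply: val_inj.
apply: (homog_indep us hf _ gs).
by have := congr1 val e; rewrite raddf_sum.
Qed.

Definition coinv : gvect k G :=
  GVect coinv_homog0 coinv_homogL coinv_span coinv_indep.

End Coinvariants.

Arguments coinv_pred {k G b H} M.

Section CoinvariantAlgebra.
Variables (k : fieldType) (G : groupType) (b : bichar k G).
Variables (H : colourHopf b) (A : comodAlg H).

Let B := coinv (alg_comodule A).

Fact coinv_one_in : ca_one A \in coinv_pred (alg_comodule A).
Proof. by apply/coinvP; apply: cma_coact1. Qed.

Fact coinv_mul_in (x y : B) : val x ∙ val y \in coinv_pred (alg_comodule A).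
Proof.
apply/coinvP; rewrite /= cma_coactM.
rewrite (coinv_val x : cma_coact _ = _) (coinv_val y : cma_coact _ = _).
exact: (bmul1 _ (ca_mul_bilinear A)).
Qed.

Definition coinv_one : B := coinv_mk coinv_one_in.
Definition coinv_mul (x y : B) : B := coinv_mk (coinv_mul_in x y).

Fact coinv_mul_bilinear : bilinear_map coinv_mul.
Proof.
by split=> [x c u v|x c u v]; apply: val_inj;
  [apply: (ca_mul_bilinear A).1|apply: (ca_mul_bilinear A).2].
Qed.
Fact coinv_mulA : associative coinv_mul.
Proof. by move=> x y z; apply: val_inj; apply: ca_mulA. Qed.
Fact coinv_mul1l : left_id coinv_one coinv_mul.
Proof. by move=> x; apply: val_inj; apply: ca_mul1l. Qed.
Fact coinv_mul1r : right_id coinv_one coinv_mul.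
Proof. by move=> x; apply: val_inj; apply: ca_mul1r. Qed.
Fact coinv_mul_homog g g' (x y : B) :
  homog B g x -> homog B g' y -> homog B (g * g')%g (coinv_mul x y).
Proof. exact: ca_mul_homog. Qed.

Definition coinv_alg : colourAlg k G :=
  @ColourAlg k G B coinv_one coinv_mul coinv_mul_bilinear coinv_mulA
    coinv_mul1l coinv_mul1r (ca_one_homog A) coinv_mul_homog.

Section CoinvariantModule.
Variable M : hopfMod A.

Fact coinv_act_in (x : coinv_alg) (m : coinv M) :
  hm_act M (val x) (val m) \in coinv_pred M.
Proof.
apply/coinvP; rewrite hm_coactM (coinv_val x : cma_coact _ = _) coinv_val.
by have [bil _ _ _] := hm_module M; apply: bmul1.
Qed.

Definition coinv_act (x : coinv_alg) (m : coinv M) : coinv M :=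
  coinv_mk (coinv_act_in x m).

Fact coinv_module : is_gmodule coinv_act.
Proof.
have [[bil1 bil2] hA h1 hg] := hm_module M; split=> [|x y m|m|g g' x m].
- by split=> [x c u v|x c u v]; apply: val_inj; [apply: bil1|apply: bil2].
- by apply: val_inj; apply: hA.
- by apply: val_inj; apply: h1.
- exact: hg.
Qed.

Definition coinv_gmod : gmod coinv_alg := GMod coinv_module.

End CoinvariantModule.
End CoinvariantAlgebra.

Section Induction.
Variables (k : fieldType) (G : groupType) (b : bichar k G).
Variables (H : colourHopf b) (A : comodAlg H).

Local Notation B := (coinv_alg A).

Section Object.
Variable N : gmod B.

(* The actions of B = A^coH that define A ⊗_B N. *)
Definition indr (x : B) (a : A) : A := a ∙ val x.
Definition indl (x : B) (n : N) : N := gm_act N x n.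

Let bilN := let: And4 h _ _ _ := gm_module N in h.
Let bilA := ca_mul_bilinear A.

Let D (U V : lmodType k) (f : U -> V) : linear f -> forall x y, f (x + y) = f x + f y.
Proof. by move=> lf x y; have := lf 1 x y; rewrite !scale1r. Qed.

Fact ind_proj g : balanced indr indl (@tens_proj k G A N B indr indl g).
Proof.
have bp := @tens_proj_bilinear k G A N B indr indl g.
have tb := tpure_bilinear indr indl.
move=> x a n.
elim/homog_ind: x => [|x y ex ey|gx x hx].
- rewrite /indr /indl (linear_0 (bilN.2 n)) (linear_0 (bp.1 a)).
  by rewrite [val _]raddf0 (linear_0 (bilA.1 a)) (linear_0 (bp.2 n)).
- rewrite /indr /indl in ex ey *.
  rewrite (D (bilN.2 n)) (D (bp.1 a)) -ex -ey [val _]raddfD.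
  by rewrite (D (bilA.1 a)) (D (bp.2 n)).
elim/homog_ind: a => [|a1 a2 e1 e2|ga a ha].
- by rewrite /indr (linear_0 (bilA.2 _)) !(linear_0 (bp.2 _)).
- by rewrite /indr (D (bilA.2 _)) !(D (bp.2 _)) e1 e2.
elim/homog_ind: n => [|n1 n2 e1 e2|gn n hn].
- by rewrite /indl (linear_0 (bilN.1 _)) !(linear_0 (bp.1 _)).
- by rewrite /indl (D (bilN.1 _)) !(D (bp.1 _)) e1 e2.
have hax : homog A (ga * gx)%g (indr x a) by apply: ca_mul_homog.
have hxn : homog N (gx * gn)%g (indl x n) by have [_ _ _] := gm_module N; apply.
have t0 i : linear (fun m : A => tpure (r := indr) (l := indl) m i) := tb.2 i.
rewrite /tens_proj (gextE _ hax); last by move=> i; exact: (linear_0 (t0 _)).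
rewrite (gextE _ ha); last by move=> i; exact: (linear_0 (t0 _)).
rewrite (gcomp_homogE _ hn) (gcomp_homogE _ hxn).
have -> : (ga^-1 * g == gx * gn)%g = (((ga * gx)^-1 * g)%g == gn).
  by rewrite -(inj_eq (mulgI (gx^-1)%g) _ (gx * gn)%g) mulKg invgM mulgA.
case: ifP => _; first exact: tpure_balanced.
by rewrite (linear_0 (tb.1 _)) (linear_0 (tb.1 _)).
Qed.

Definition indG : gvect k G := @tensG k G A N B indr indl ind_proj.

(* a ⊗_B n *)
Definition tB (a : A) (n : N) : indG := tpure (r := indr) (l := indl) a n.

Lemma tB_bilinear : bilinear_map tB.
Proof. exact: tpure_bilinear. Qed.

Lemma tB_balanced (x : B) a n : tB (a ∙ val x) n = tB a (gm_act N x n).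
Proof. exact: (tpure_balanced indr indl). Qed.

Lemma indG_ind (P : indG -> Prop) :
  P 0 -> (forall x y, P x -> P y -> P (x + y)) -> (forall a n, P (tB a n)) ->
  forall x, P x.
Proof. exact: tens_ind. Qed.

Lemma indG_ext (W : lmodType k) (f g : indG -> W) :
  linear f -> linear g -> (forall a n, f (tB a n) = g (tB a n)) -> f =1 g.
Proof. exact: tens_ext. Qed.

Lemma tB_homog g g' a n :
  homog A g a -> homog N g' n -> homog indG (g * g')%g (tB a n).
Proof. exact: tens_homog_pure. Qed.

Definition blift (W : lmodType k) (f : A -> N -> W) (x : indG) : W :=
  @tlift k A N B indr indl W f x.

Section BLift.
Variables (W : lmodType k) (f : A -> N -> W).
Hypothesis bf : bilinear_map f.
Hypothesis baf : forall (x : B) a n, f (a ∙ val x) n = f a (gm_act N x n).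

Lemma bliftE a n : blift f (tB a n) = f a n.
Proof. by apply: tliftE. Qed.

Lemma blift_linear : linear (blift f).
Proof. by apply: tlift_linear. Qed.
End BLift.

Lemma blift_graded (W : gvect k G) (f : A -> N -> W) : bilinear_map f ->
  (forall (x : B) a n, f (a ∙ val x) n = f a (gm_act N x n)) ->
  (forall g g' a n, homog A g a -> homog N g' n -> homog W (g * g')%g (f a n)) ->
  graded_map (blift f).
Proof.
move=> bf baf hf g _ [s [-> hs]]; have lf := blift_linear bf baf.
elim: s hs => [|p s IHs] hs; first by rewrite big_nil linear_0 //; apply: homog0.
rewrite big_cons (D lf).
apply: homogD; last by apply: IHs => q qs; apply: hs; rewrite inE qs orbT.
have [g' [g'' [<- h1 h2]]] := hs p (mem_head _ _).
by rewrite (bliftE bf baf p.1 p.2); apply: hf.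
Qed.

Definition ind_act (a : A) (x : indG) : indG := blift (fun a' n => tB (a ∙ a') n) x.

(* χ(a ⊗_B n) = a_(-1) ⊗ (a_(0) ⊗_B n) *)
Definition ind_coact (x : indG) : (H ⊗ indG)%type :=
  blift (fun a n => tmap (N' := indG) id (fun a0 : A => tB a0 n) (cma_coact a)) x.

Let actA a : bilinear_map (fun a' n => tB (a ∙ a') n).
Proof.
split=> [a'|n]; first exact: tB_bilinear.1.
exact: (lin_comp (tB_bilinear.2 n) (bilA.1 a)).
Qed.

Let actB a (x : B) a' n : tB (a ∙ (a' ∙ val x)) n = tB (a ∙ a') (gm_act N x n).
Proof. by rewrite ca_mulA tB_balanced. Qed.

Lemma ind_actE a a' n : ind_act a (tB a' n) = tB (a ∙ a') n.
Proof. exact: (bliftE (actA a) (actB a)). Qed.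

Lemma ind_act_linear a : linear (ind_act a).
Proof. exact: (blift_linear (actA a) (actB a)). Qed.

Lemma ind_module : is_gmodule ind_act.
Proof.
have lin2 x : linear (ind_act^~ x).
  apply: (tlift_param (F := fun a a' n => tB (a ∙ a') n)) => a' n.
  exact: (lin_comp (tB_bilinear.2 n) (bilA.2 a')).
split=> [|a a' x|x|g g' a x ha].
- by split=> [a|x]; [apply: ind_act_linear|apply: lin2].
- move: x; apply: indG_ext; first exact: ind_act_linear.
    exact: (lin_comp (ind_act_linear a) (ind_act_linear a')).
  by move=> a0 n; rewrite !ind_actE ca_mulA.
- move: x; apply: indG_ext; [exact: ind_act_linear|exact: lin_id|].
  by move=> a n; rewrite ind_actE ca_mul1l.
- move=> [s [-> hs]].
  elim: s hs => [|p s IHs] hs.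
    by rewrite big_nil (linear_0 (ind_act_linear a)); apply: homog0.
  rewrite big_cons (D (ind_act_linear a)).
  apply: homogD; last by apply: IHs => q qs; apply: hs; rewrite inE qs orbT.
  have [h [h' [<- h1 h2]]] := hs p (mem_head _ _).
  rewrite (ind_actE a p.1 p.2) mulgA.
  by apply: tB_homog => //; apply: ca_mul_homog.
Qed.

Definition indK (n : N) (y : (H ⊗ A)%type) : (H ⊗ indG)%type :=
  tmap (N' := indG) id (fun a0 : A => tB a0 n) y.

Let indKE n h a : indK n (h ⊗ a) = h ⊗ tB a n.
Proof. exact: (tmapE _ _ (@lin_id k H) (tB_bilinear.2 n)). Qed.

Let indK_linear n : linear (indK n).
Proof. exact: (tmap_linear (@lin_id k H) (tB_bilinear.2 n)). Qed.

Let rhoA : bilinear_map (fun a n => indK n (cma_coact a)).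
Proof.
split=> [a|n]; last exact: (lin_comp (indK_linear n) (linearP cma_coact)).
apply: (klift_param (F := fun n h a0 => h ⊗ tB a0 n)) => h a0.
exact: (lin_comp ((tk_bilinear H indG).1 h) (tB_bilinear.1 a0)).
Qed.

Let rhoB (x : B) a n :
  indK n (cma_coact (a ∙ val x)) = indK (gm_act N x n) (cma_coact a).
Proof.
rewrite cma_coactM (coinv_val x : cma_coact _ = _).
move: (cma_coact a); apply: tensk_ext.
- apply: lin_comp; first exact: indK_linear.
  exact: (bmul_linearl _ bilA).
- exact: indK_linear.
move=> h a0; rewrite (bmul1 _ bilA h a0 (val x)) !indKE.
by congr (_ ⊗ _); apply: tB_balanced.
Qed.

Lemma ind_coactE a n : ind_coact (tB a n) = indK n (cma_coact a).
Proof. exact: (bliftE rhoA rhoB). Qed.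

Lemma ind_coact_linear : linear ind_coact.
Proof. exact: (blift_linear rhoA rhoB). Qed.

HB.instance Definition _ :=
  GRing.isLinear.Build k indG (H ⊗ indG)%type _ ind_coact ind_coact_linear.

Let eps_bil (M : gvect k G) : bilinear_map (fun (h : H) (m : M) => counit h *: m).
Proof.
split=> [h c u v|m c u v]; last by rewrite linearP scalerDl scalerA.
by rewrite scalerDr !scalerA mulrC.
Qed.

Lemma ind_coaction : is_coaction ind_coact.
Proof.
have [cg cA c1] := cma_coactP A.
have lA : linear (@cma_coact k G b H A) := linearP _.
have lD : linear (@comul k G b H) := linearP _.
split.
- apply: blift_graded rhoA rhoB _ => g g' a n ha hn.
  have [s [-> hs]] := cg _ _ ha.
  elim: s hs => [|p s IHs] hs.
    by rewrite big_nil (linear_0 (indK_linear n)); apply: homog0.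
  rewrite big_cons (D (indK_linear n)).
  apply: homogD; last by apply: IHs => q qs; apply: hs; rewrite inE qs orbT.
  have [h [h' [<- h1 h2]]] := hs p (mem_head _ _).
  rewrite (indKE n p.1 p.2) -mulgA; apply: tk_homog => //.
  exact: tB_homog.
- have l1 (M : gvect k G) :
      linear (fun y => tassoc (tmap (M' := (H ⊗ H)%type) (N' := M) (comul) id y)).
    apply: lin_comp; first exact: tassoc_linear.
    by apply: tmap_linear => //; apply: lin_id.
  have l2 : linear (tmap (N' := (H ⊗ indG)%type) (@id H) ind_coact).
    by apply: tmap_linear; [apply: lin_id|apply: ind_coact_linear].
  have lK n : linear (tmap (N' := (H ⊗ indG)%type) (@id H) (indK n)).
    by apply: tmap_linear; [apply: lin_id|apply: indK_linear].
  have lX : linear (tmap (N' := (H ⊗ A)%type) (@id H) (@cma_coact k G b H A)).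
    by apply: tmap_linear; [apply: lin_id|].
  apply: indG_ext.
  + by apply: (lin_comp (l1 _)); apply: ind_coact_linear.
  + by apply: (lin_comp l2); apply: ind_coact_linear.
  move=> a n; rewrite ind_coactE.
  transitivity (tmap (N' := (H ⊗ indG)%type) id (indK n)
     (tassoc (tmap (M' := (H ⊗ H)%type) (comul) id (cma_coact a)))).
    move: (cma_coact a); apply: tensk_ext.
    * by apply: (lin_comp (l1 _)); apply: indK_linear.
    * exact: (lin_comp (lK n) (l1 _)).
    move=> h a0; rewrite indKE.
    rewrite (tmapE (M' := (H ⊗ H)%type) h (tB a0 n) lD (@lin_id k _)).
    rewrite (tmapE (M' := (H ⊗ H)%type) h a0 lD (@lin_id k _)).
    move: (comul h); apply: tensk_ext.
    * apply: lin_comp; [exact: tassoc_linear|exact: (tk_bilinear (H ⊗ H) indG).2].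
    * apply: (lin_comp (lK n)); apply: lin_comp; first exact: tassoc_linear.
      exact: (tk_bilinear (H ⊗ H) A).2.
    move=> u v; rewrite !tassocE.
    rewrite (tmapE (N' := (H ⊗ indG)%type) u (v ⊗ a0) (@lin_id k _) (indK_linear n)).
    by rewrite indKE.
  rewrite cA; move: (cma_coact a); apply: tensk_ext.
  + exact: (lin_comp (lK n) lX).
  + exact: (lin_comp l2 (indK_linear n)).
  move=> h a0; rewrite indKE.
  rewrite (tmapE (N' := (H ⊗ A)%type) h a0 (@lin_id k _) lA).
  rewrite (tmapE (N' := (H ⊗ indG)%type) _ _ (@lin_id k _) (indK_linear n)).
  rewrite (tmapE (N' := (H ⊗ indG)%type) _ _ (@lin_id k _) ind_coact_linear).
  by rewrite ind_coactE.
- have le M := klift_linear (eps_bil M).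
  apply: indG_ext; [|exact: lin_id|].
    exact: (lin_comp (le _) ind_coact_linear).
  move=> a n; rewrite ind_coactE -[in RHS](c1 a).
  move: (cma_coact a); apply: tensk_ext.
  + exact: (lin_comp (le _) (indK_linear n)).
  + exact: (lin_comp (tB_bilinear.2 n) (le _)).
  move=> h a0; rewrite indKE (kliftE _ _ (eps_bil indG)) (kliftE _ _ (eps_bil A)).
  have := tB_bilinear.2 n (counit h) a0 0.
  by rewrite (linear_0 (tB_bilinear.2 n)) !addr0.
Qed.

Definition ind_comodule : comodule H :=
  @Comodule k G b H indG ind_coact ind_coaction.

Fact ind_coactM a (x : indG) :
  ind_coact (ind_act a x) = bmul b ind_act (cma_coact a) (ind_coact x).
Proof.
have [bact _ _ _] := ind_module.
have lr (y : (H ⊗ A)%type) : linear (bmul b ind_act y) := bmul_linearr b bact y.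
move: x; apply: indG_ext.
- exact: (lin_comp ind_coact_linear (ind_act_linear a)).
- exact: (lin_comp (lr _) ind_coact_linear).
move=> a' n; rewrite ind_actE !ind_coactE cma_coactM.
move: (cma_coact a); apply: tensk_ext.
- exact: (lin_comp (indK_linear n) (bmul_linearl _ bilA _)).
- exact: bmul_linearl.
move=> h u; move: (cma_coact a'); apply: tensk_ext.
- exact: (lin_comp (indK_linear n) (bmul_linearr _ bilA _)).
- exact: (lin_comp (lr _) (indK_linear n)).
move=> h' v; rewrite indKE.
elim/homog_ind: u => [|u1 u2 e1 e2|g u hu].
- rewrite !(linear_0 ((tk_bilinear H A).1 _)).
  rewrite (linear_0 (bmul_linearl _ bilA _)) (linear_0 (bmul_linearl _ bact _)).
  exact: linear_0.
- rewrite !(D ((tk_bilinear H A).1 _)).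
  rewrite (D (bmul_linearl _ bilA _)) (D (bmul_linearl _ bact _)).
  by rewrite (D (indK_linear n)) e1 e2.
elim/homog_ind: h' => [|u1 u2 e1 e2|g' h' hh'].
- rewrite (linear_0 ((tk_bilinear H A).2 _)) (linear_0 ((tk_bilinear H indG).2 _)).
  rewrite (linear_0 (bmul_linearr _ bilA _)) (linear_0 (lr _)).
  exact: linear_0.
- rewrite (D ((tk_bilinear H A).2 _)) (D ((tk_bilinear H indG).2 _)).
  rewrite (D (bmul_linearr _ bilA _)) (D (lr _)).
  by rewrite (D (indK_linear n)) e1 e2.
rewrite (bmulE _ bilA _ _ hu hh') (bmulE _ bact _ _ hu hh').
have -> c y : indK n (c *: y) = c *: indK n y.
  by have := indK_linear n c y 0; rewrite (linear_0 (indK_linear n)) !addr0.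
by rewrite indKE ind_actE.
Qed.

Definition ind_hopf : hopfMod A :=
  @HopfMod k G b H A ind_comodule ind_act ind_module ind_coactM.

End Object.
End Induction.

Section Morphisms.
Variables (k : fieldType) (G : groupType).

Section GModHom.
Variables (R : colourAlg k G) (M N : gmod R).

Definition is_gmod_hom (f : M -> N) : Prop :=
  [/\ linear f, graded_map f &
      forall a m, f (gm_act M a m) = gm_act N a (f m)].

Definition gmod_hom_pred : {pred M -> N} := fun f => `[< is_gmod_hom f >].

Record gmod_hom := GmodHom {
  gmod_fun :> M -> N;
  gmod_homP : gmod_fun \in gmod_hom_pred }.

Fact gmod_hom_submod : submod_closed gmod_hom_pred.
Proof.
have [[bil _] _ _ _] := gm_module N.
split=> [|c f g /asboolP[lf hf af] /asboolP[lg hg ag]]; apply/asboolP; split.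
- by move=> c u v; rewrite scaler0 addr0.
- by move=> h v _; apply: homog0.
- by move=> a m; rewrite (linear_0 (bil a)).
- move=> d u v; rewrite -![(c *: f + g) _]/(c *: f _ + g _) lf lg.
  by rewrite !scalerDr !scalerA addrACA mulrC.
- by move=> h v hv; apply: homogL; [apply: hf|apply: hg].
- by move=> a m; rewrite -![(c *: f + g) _]/(c *: f _ + g _) af ag bil.
Qed.

HB.instance Definition _ :=
  GRing.isSubmodClosed.Build k (M -> N) gmod_hom_pred gmod_hom_submod.
HB.instance Definition _ := [isSub for gmod_fun].
HB.instance Definition _ := [Choice of gmod_hom by <:].
HB.instance Definition _ := [SubChoice_isSubLmodule of gmod_hom by <:].

Lemma gmod_hom_ax (f : gmod_hom) : is_gmod_hom f.
Proof. by apply/asboolP; apply: gmod_homP. Qed.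

Definition mk_gmod_hom f (h : is_gmod_hom f) : gmod_hom := GmodHom (asboolT h).

Lemma gmod_hom_eq (f g : gmod_hom) : f =1 g -> f = g.
Proof. by move=> e; apply: val_inj; apply: funext. Qed.

End GModHom.

Variables (b : bichar k G) (H : colourHopf b) (A : comodAlg H).

Section HopfHom.
Variables M N : hopfMod A.

Definition is_hopf_hom (f : M -> N) : Prop :=
  [/\ linear f, graded_map f,
      forall a m, f (hm_act M a m) = hm_act N a (f m) &
      forall m, coact (f m) = tmap id f (coact m)].

Definition hopf_hom_pred : {pred M -> N} := fun f => `[< is_hopf_hom f >].

Record hopf_hom := HopfHom {
  hopf_fun :> M -> N;
  hopf_homP : hopf_fun \in hopf_hom_pred }.

Fact hopf_hom_submod : submod_closed hopf_hom_pred.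
Proof.
have [[bil _] _ _ _] := hm_module N.
have lc : linear (@coact k G b H N) := linearP _.
have [t1 t2] := tk_bilinear H N.
split=> [|c f g /asboolP[lf hf af cf] /asboolP[lg hg ag cg]]; apply/asboolP; split.
- by move=> c u v; rewrite scaler0 addr0.
- by move=> h v _; apply: homog0.
- by move=> a m; rewrite (linear_0 (bil a)).
- move=> m; rewrite (linear_0 lc) /tmap /klift /tlift big1 // => p _.
  exact: (linear_0 (t1 _)).
- move=> d u v; rewrite -![(c *: f + g) _]/(c *: f _ + g _) lf lg.
  by rewrite !scalerDr !scalerA addrACA mulrC.
- by move=> h v hv; apply: homogL; [apply: hf|apply: hg].
- by move=> a m; rewrite -![(c *: f + g) _]/(c *: f _ + g _) af ag bil.
- move=> m; rewrite -![(c *: f + g) _]/(c *: f _ + g _) lc cf cg.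
  rewrite /tmap /klift /tlift scaler_sumr -big_split /=.
  by apply: eq_bigr => p _; rewrite -t1.
Qed.

HB.instance Definition _ :=
  GRing.isSubmodClosed.Build k (M -> N) hopf_hom_pred hopf_hom_submod.
HB.instance Definition _ := [isSub for hopf_fun].
HB.instance Definition _ := [Choice of hopf_hom by <:].
HB.instance Definition _ := [SubChoice_isSubLmodule of hopf_hom by <:].

Lemma hopf_hom_ax (f : hopf_hom) : is_hopf_hom f.
Proof. by apply/asboolP; apply: hopf_homP. Qed.

Definition mk_hopf_hom f (h : is_hopf_hom f) : hopf_hom := HopfHom (asboolT h).

Lemma hopf_hom_eq (f g : hopf_hom) : f =1 g -> f = g.
Proof. by move=> e; apply: val_inj; apply: funext. Qed.

End HopfHom.

End Morphisms.

Local Obligation Tactic := idtac.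

Record category := Category {
  ob :> Type;
  mor : ob -> ob -> Type;
  idm : forall X, mor X X;
  mcomp : forall X Y Z, mor Y Z -> mor X Y -> mor X Z;
  mcomp1m : forall X Y (f : mor X Y), mcomp (idm Y) f = f;
  mcompm1 : forall X Y (f : mor X Y), mcomp f (idm X) = f;
  mcompA : forall X Y Z T (f : mor Z T) (g : mor Y Z) (h : mor X Y),
    mcomp f (mcomp g h) = mcomp (mcomp f g) h }.

Arguments idm {c} X.
Arguments mcomp {c X Y Z} f g.
Notation "f ∘ g" := (mcomp f g) (at level 50, left associativity).

Record functor (C D : category) := Functor {
  fob :> C -> D;
  fmap : forall X Y, mor X Y -> mor (fob X) (fob Y);
  fmap1 : forall X, fmap (idm X) = idm (fob X);
  fmapM : forall X Y Z (f : mor Y Z) (g : mor X Y), fmap (f ∘ g) = fmap f ∘ fmap g }.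

Arguments fmap {C D} f {X Y} u : rename.

Definition functor1 (C : category) : functor C C :=
  @Functor C C id (fun X Y f => f) (fun X => erefl) (fun X Y Z f g => erefl).

Program Definition functorM (C D E : category) (F : functor D E) (G : functor C D) :
    functor C E :=
  @Functor C E (fun X => F (G X)) (fun X Y f => fmap F (fmap G f)) _ _.
Next Obligation. by move=> C D E F G X; rewrite /= !fmap1. Qed.
Next Obligation. by move=> C D E F G X Y Z f g; rewrite /= !fmapM. Qed.

Record nattrans (C D : category) (F G : functor C D) := NatTrans {
  ncomp :> forall X, mor (F X) (G X);
  naturality : forall X Y (f : mor X Y), ncomp Y ∘ fmap F f = fmap G f ∘ ncomp X }.

(* F is left adjoint to G with unit eta and counit eps. *)
Definition is_adjunction (C D : category) (F : functor C D) (G : functor D C)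
    (eta : nattrans (functor1 C) (functorM G F))
    (eps : nattrans (functorM F G) (functor1 D)) : Prop :=
  (forall X : C, (eps (F X) : mor (F (G (F X))) (F X)) ∘ fmap F (eta X : mor X (G (F X)))
     = idm (F X)) /\
  (forall Y : D, fmap G (eps Y : mor (F (G Y)) Y) ∘ (eta (G Y) : mor (G Y) (G (F (G Y))))
     = idm (G Y)).

Section Categories.
Variables (k : fieldType) (G : groupType).

Section GModCat.
Variable R : colourAlg k G.

Fact gmod_id_subproof (M : gmod R) : is_gmod_hom (M := M) (N := M) id.
Proof. by split. Qed.

Fact gmod_comp_subproof (M N P : gmod R) (f : gmod_hom N P) (g : gmod_hom M N) :
  is_gmod_hom (fun m => f (g m)).
Proof.
have [lf hf af] := gmod_hom_ax f; have [lg hg ag] := gmod_hom_ax g.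
split=> [c u v|h v hv|a m]; first by rewrite lg lf.
  by apply: hf; apply: hg.
by rewrite ag af.
Qed.

Program Definition gmodCat : category :=
  @Category (gmod R) (@gmod_hom k G R)
    (fun M => mk_gmod_hom (gmod_id_subproof M))
    (fun M N P f g => mk_gmod_hom (gmod_comp_subproof f g)) _ _ _.
Next Obligation. by move=> M N f; apply: gmod_hom_eq. Qed.
Next Obligation. by move=> M N f; apply: gmod_hom_eq. Qed.
Next Obligation. by move=> M N P Q f g h; apply: gmod_hom_eq. Qed.

End GModCat.

Variables (b : bichar k G) (H : colourHopf b) (A : comodAlg H).

Fact hopf_id_subproof (M : hopfMod A) : is_hopf_hom (M := M) (N := M) id.
Proof.
split=> // m; move: (coact m); apply: tensk_ext => //.
  by apply: tmap_linear; apply: lin_id.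
by move=> h m'; rewrite tmapE.
Qed.

Fact hopf_comp_subproof (M N P : hopfMod A) (f : hopf_hom N P) (g : hopf_hom M N) :
  is_hopf_hom (fun m => f (g m)).
Proof.
have [lf hf af cf] := hopf_hom_ax f; have [lg hg ag cg] := hopf_hom_ax g.
have li : linear (@id H) by [].
split=> [c u v|h v hv|a m|m]; first by rewrite lg lf.
- by apply: hf; apply: hg.
- by rewrite ag af.
rewrite cf cg; move: (coact m); apply: tensk_ext.
- exact: lin_comp (tmap_linear li lf) (tmap_linear li lg).
- exact: tmap_linear li (lin_comp lf lg).
move=> h m'; rewrite (tmapE h m' li lg) (tmapE h (g m') li lf).
by rewrite (tmapE h m' li (lin_comp lf lg)).
Qed.

Program Definition hopfCat : category :=
  @Category (hopfMod A) (@hopf_hom k G b H A)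
    (fun M => mk_hopf_hom (hopf_id_subproof M))
    (fun M N P f g => mk_hopf_hom (hopf_comp_subproof f g)) _ _ _.
Next Obligation. by move=> M N f; apply: hopf_hom_eq. Qed.
Next Obligation. by move=> M N f; apply: hopf_hom_eq. Qed.
Next Obligation. by move=> M N P Q f g h; apply: hopf_hom_eq. Qed.

Fact coinv_map_in (M N : hopfMod A) (f : hopf_hom M N) (m : coinv M) :
  f (val m) \in coinv_pred N.
Proof.
have [lf hf af cf] := hopf_hom_ax f.
apply/coinvP; rewrite cf coinv_val.
by rewrite (tmapE _ _ (@lin_id k H) lf).
Qed.

Definition coinv_map (M N : hopfMod A) (f : hopf_hom M N) :
    coinv_gmod M -> coinv_gmod N :=
  fun m => coinv_mk (coinv_map_in f m).

Fact coinv_map_subproof (M N : hopfMod A) (f : hopf_hom M N) :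
  is_gmod_hom (coinv_map f).
Proof.
have [lf hf af cf] := hopf_hom_ax f.
split=> [c u v|g m|a m]; [|exact: hf|].
  by apply: val_inj; apply: lf.
by apply: val_inj; apply: af.
Qed.

Program Definition coinvF : functor hopfCat (gmodCat (coinv_alg A)) :=
  @Functor hopfCat (gmodCat (coinv_alg A)) (@coinv_gmod k G b H A)
    (fun M N f => mk_gmod_hom (coinv_map_subproof f)) _ _.
Next Obligation. by move=> M; apply: gmod_hom_eq => m; apply: val_inj. Qed.
Next Obligation. by move=> M N P f g; apply: gmod_hom_eq => m; apply: val_inj. Qed.

Definition ind_map (N N' : gmod (coinv_alg A)) (f : gmod_hom N N') :
    ind_hopf N -> ind_hopf N' :=
  @blift k G b H A N (indG N') (fun a n => tB a (f n)).

Section IndMap.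
Variables (N N' : gmod (coinv_alg A)) (f : gmod_hom N N').

Let lf : linear f. Proof. by have [] := gmod_hom_ax f. Qed.

Let fA : bilinear_map (fun a n => tB a (f n)).
Proof.
split=> [a|n]; last exact: (tB_bilinear N').2.
exact: lin_comp ((tB_bilinear N').1 a) lf.
Qed.

Let fB (x : coinv_alg A) a n : tB (a ∙ val x) (f n) = tB a (f (gm_act N x n)).
Proof. by have [_ _ ->] := gmod_hom_ax f; rewrite tB_balanced. Qed.

Lemma ind_mapE a n : ind_map f (tB a n) = tB a (f n).
Proof. exact: (bliftE fA fB). Qed.

Lemma ind_map_linear : linear (ind_map f).
Proof. exact: (blift_linear fA fB). Qed.

Lemma ind_map_subproof : is_hopf_hom (ind_map f).
Proof.
have lm := ind_map_linear; have li : linear (@id H) by [].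
have [_ hf _] := gmod_hom_ax f.
split=> //.
- apply: blift_graded fA fB _ => g g' a n ha hn.
  by apply: tB_homog => //; apply: hf.
- move=> a; apply: indG_ext.
  + exact: lin_comp lm (ind_act_linear a).
  + exact: lin_comp (ind_act_linear a) lm.
  by move=> a' n; rewrite /= ind_actE !ind_mapE ind_actE.
- apply: indG_ext.
  + exact: lin_comp (@ind_coact_linear k G b H A N') lm.
  + exact: lin_comp (tmap_linear li lm) (@ind_coact_linear k G b H A N).
  move=> a n; rewrite ind_mapE /= !ind_coactE.
  move: (cma_coact a); apply: tensk_ext.
  + exact: tmap_linear li ((tB_bilinear N').2 (f n)).
  + exact: lin_comp (tmap_linear li lm) (tmap_linear li ((tB_bilinear N).2 n)).
  move=> h a0; rewrite /indK (tmapE h a0 li ((tB_bilinear N').2 (f n))).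
  rewrite (tmapE h a0 li ((tB_bilinear N).2 n)) (tmapE h _ li lm).
  by rewrite ind_mapE.
Qed.

End IndMap.

Program Definition indF : functor (gmodCat (coinv_alg A)) hopfCat :=
  @Functor (gmodCat (coinv_alg A)) hopfCat (@ind_hopf k G b H A)
    (fun N N' f => mk_hopf_hom (ind_map_subproof f)) _ _.
Next Obligation.
move=> N; apply: hopf_hom_eq; apply: indG_ext.
- exact: ind_map_linear.
- exact: lin_id.
by move=> a n; rewrite /= ind_mapE.
Qed.
Next Obligation.
move=> N N' N'' f g; apply: hopf_hom_eq; apply: indG_ext.
- exact: ind_map_linear.
- exact: lin_comp (ind_map_linear f) (ind_map_linear g).
by move=> a n; rewrite /= !ind_mapE.
Qed.

End Categories.

Arguments indF {k G b H} A.
Arguments coinvF {k G b H} A.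

(* Main.v *)
(* A Hopf module map out of A ⊗_B N is determined by its values on the elements
   1 ⊗ n, which are coinvariant because the coaction fixes 1. Conversely
   a ⊗ n |-> a g(n) is colinear because g(n) is coinvariant, so that the braiding
   factor in the coaction of a g(n) is (|a_(0)| / e) = 1. *)
Require Import Defs.
From HB Require Import structures.
From mathcomp Require Import all_boot all_order all_algebra.
From mathcomp Require Import mathcomp_extra boolp functions.

Set Implicit Arguments.
Unset Strict Implicit.
Unset Printing Implicit Defensive.

Import GRing.Theory.
Local Open Scope ring_scope.

Section HomAdjunction.
Variables (k : fieldType) (G : groupType) (b : bichar k G).
Variables (H : colourHopf b) (A : comodAlg H).

Section Adjuncts.
Variables (N : gmod (coinv_alg A)) (M : hopfMod A).

Lemma tB_one_coinv (n : N) : tB (ca_one A) n \in coinv_pred (ind_hopf N).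
Proof.
apply/coinvP; rewrite [LHS]ind_coactE cma_coact1.
exact: tmapE (@lin_id k H) ((tB_bilinear N).2 n).
Qed.

(** Moving [x] across the tensor sign turns [1 ⊗ x n] into [x ⊗ n]; this is what makes
    [n |-> f (1 ⊗ n)] B-linear. *)
Lemma tB_one_act (x : coinv_alg A) (n : N) :
  tB (ca_one A) (gm_act N x n) = ind_act (val x) (tB (ca_one A) n).
Proof. by rewrite -tB_balanced ca_mul1l ind_actE ca_mul1r. Qed.

(** [1 ⊗ n] is packed as a coinvariant so that [coinv_map_in], by which Hopf module maps preserve
    coinvariants, places its image in [coinv M]. *)
Definition right_adjunct_fun (f : hopf_hom (ind_hopf N) M) (n : N) :
    coinv_gmod M :=
  coinv_mk (coinv_map_in f (coinv_mk (tB_one_coinv n))).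

Lemma right_adjunct_is_gmod_hom (f : hopf_hom (ind_hopf N) M) :
  is_gmod_hom (right_adjunct_fun f).
Proof.
have [lf hf af _] := hopf_hom_ax f; split=> [c u v|g n hn|x n].
- by apply: val_inj; rewrite /= (tB_bilinear N).1 lf.
(* The unit of A has degree e, so [1 ⊗ n] has the same degree as [n]. *)
- by apply: hf; rewrite -[g]mul1g; apply: tB_homog hn; apply: ca_one_homog.
- by apply: val_inj; rewrite /= tB_one_act; apply: af.
Qed.

Definition right_adjunct (f : hopf_hom (ind_hopf N) M) :
    gmod_hom N (coinv_gmod M) :=
  mk_gmod_hom (right_adjunct_is_gmod_hom f).

(** The operations on both Hom spaces are pointwise, so evaluation at [1 ⊗ n] respects them by
    computation. *)
Lemma right_adjunct_linear : linear right_adjunct.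
Proof. by move=> c f g; apply: gmod_hom_eq => n; apply: val_inj. Qed.

HB.instance Definition _ := GRing.isLinear.Build k
  (hopf_hom (ind_hopf N) M) (gmod_hom N (coinv_gmod M)) _
  right_adjunct right_adjunct_linear.

Section LeftAdjunct.
Variable g : gmod_hom N (coinv_gmod M).

Definition left_adjunct_fun : ind_hopf N -> M :=
  @blift k G b H A N M (fun a n => hm_act M a (val (g n))).

Lemma left_adjunct_bilinear :
  bilinear_map (fun a (n : N) => hm_act M a (val (g n))).
Proof.
have [bil _ _ _] := hm_module M; have [lg _ _] := gmod_hom_ax g.
split=> [a c u v|n]; last exact: bil.2.
by rewrite lg; apply: bil.1.
Qed.

(** B acts on the coinvariants by restricting the action of A, so B-linearity of [g] and
    associativity bring both sides to [a (x g(n))]. *)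
Lemma left_adjunct_balanced (x : coinv_alg A) a (n : N) :
  hm_act M (a ∙ val x) (val (g n)) = hm_act M a (val (g (gm_act N x n))).
Proof.
have [_ hA _ _] := hm_module M; have [_ _ ag] := gmod_hom_ax g.
by rewrite ag hA.
Qed.

Lemma left_adjunct_funE a (n : N) :
  left_adjunct_fun (tB a n) = hm_act M a (val (g n)).
Proof. exact: bliftE left_adjunct_bilinear left_adjunct_balanced a n. Qed.

Lemma left_adjunct_fun_linear : linear left_adjunct_fun.
Proof. exact: blift_linear left_adjunct_bilinear left_adjunct_balanced. Qed.

Lemma left_adjunct_is_hopf_hom : is_hopf_hom left_adjunct_fun.
Proof.
have [bil hA _ hM] := hm_module M; have [_ hg _] := gmod_hom_ax g.
have lf := left_adjunct_fun_linear; have li := @lin_id k H.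
split=> //.
- apply: blift_graded left_adjunct_bilinear left_adjunct_balanced _.
  by move=> d d' a n ha hn; apply: hM => //; apply: hg.
- move=> a; apply: indG_ext.
  + exact: lin_comp lf (ind_act_linear a).
  + exact: lin_comp (bil.1 a) lf.
  by move=> a' n; rewrite /= ind_actE !left_adjunct_funE hA.
- apply: indG_ext.
  + exact: lin_comp (linearP coact) lf.
  + exact: lin_comp (tmap_linear li lf) (@ind_coact_linear k G b H A N).
  move=> a n; rewrite left_adjunct_funE hm_coactM coinv_val /= ind_coactE.
  (* Both sides are linear in the coaction of [a], so it may be replaced by a pure tensor [h ⊗ a0];
     there [bmul1] removes the braiding factor. *)
  move: (cma_coact a); apply: tensk_ext.
  + exact: bmul_linearl.
  + exact: lin_comp (tmap_linear li lf) (tmap_linear li ((tB_bilinear N).2 n)).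
  move=> h a0; rewrite (bmul1 _ bil) /indK (tmapE h a0 li ((tB_bilinear N).2 n)).
  by rewrite (tmapE h _ li lf) left_adjunct_funE.
Qed.

Definition left_adjunct : hopf_hom (ind_hopf N) M :=
  mk_hopf_hom left_adjunct_is_hopf_hom.

Lemma left_adjunctE a (n : N) : left_adjunct (tB a n) = hm_act M a (val (g n)).
Proof. exact: left_adjunct_funE. Qed.

End LeftAdjunct.

(** The elements [a ⊗ n] span the induced module; equalities of Hopf module maps out of it are
    checked on them below. *)
Lemma hopf_hom_ind_ext (f f' : hopf_hom (ind_hopf N) M) :
  (forall a n, f (tB a n) = f' (tB a n)) -> f = f'.
Proof.
have [lf _ _ _] := hopf_hom_ax f; have [lf' _ _ _] := hopf_hom_ax f'.
by move=> e; apply: hopf_hom_eq; apply: indG_ext.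
Qed.

(** Since [a ⊗ n = a (1 ⊗ n)], A-linearity of [f] gives [a f(1 ⊗ n) = f(a ⊗ n)]. *)
Lemma right_adjunctK : cancel right_adjunct left_adjunct.
Proof.
move=> f; apply: hopf_hom_ind_ext => a n; rewrite left_adjunctE /=.
have [_ _ af _] := hopf_hom_ax f.
by rewrite -af /= ind_actE ca_mul1r.
Qed.

Lemma left_adjunctK : cancel left_adjunct right_adjunct.
Proof.
move=> g; apply: gmod_hom_eq => n; apply: val_inj; rewrite /= left_adjunct_funE.
by have [_ _ h1 _] := hm_module M.
Qed.

End Adjuncts.

(** As for any adjunction given by bijections of Hom sets, the unit and the counit are the adjuncts
    of identity maps. *)
Definition ind_unit (N : gmod (coinv_alg A)) :
    gmod_hom N (coinv_gmod (ind_hopf N)) :=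
  right_adjunct (idm (ind_hopf N : hopfCat A)).

Definition ind_counit (M : hopfMod A) : hopf_hom (ind_hopf (coinv_gmod M)) M :=
  left_adjunct (idm (coinv_gmod M : gmodCat (coinv_alg A))).

Lemma ind_counitE (M : hopfMod A) a (m : coinv_gmod M) :
  ind_counit M (tB a m) = hm_act M a (val m).
Proof. exact: left_adjunctE. Qed.

Lemma ind_unit_natural (N N' : gmodCat (coinv_alg A)) (u : mor N N') :
  (ind_unit N' : mor N' (coinvF A (indF A N'))) ∘ u =
  fmap (coinvF A) (fmap (indF A) u) ∘
    (ind_unit N : mor N (coinvF A (indF A N))).
Proof.
apply: gmod_hom_eq => n; apply: val_inj.
by rewrite /= ind_mapE.
Qed.

(** Both composites send [a ⊗ m] to [a v(m)], by A-linearity of [v]. *)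
Lemma ind_counit_natural (M M' : hopfCat A) (v : mor M M') :
  (ind_counit M' : mor (indF A (coinvF A M')) M') ∘
    fmap (indF A) (fmap (coinvF A) v) =
  v ∘ (ind_counit M : mor (indF A (coinvF A M)) M).
Proof.
apply: hopf_hom_ind_ext => a m.
have [_ _ av _] := hopf_hom_ax v.
by rewrite /= ind_mapE !left_adjunct_funE /= av.
Qed.

Definition ind_unit_nat :
    nattrans (functor1 (gmodCat (coinv_alg A))) (functorM (coinvF A) (indF A)) :=
  @NatTrans _ _ (functor1 (gmodCat (coinv_alg A)))
    (functorM (coinvF A) (indF A)) ind_unit ind_unit_natural.

Definition ind_counit_nat :
    nattrans (functorM (indF A) (coinvF A)) (functor1 (hopfCat A)) :=
  @NatTrans _ _ (functorM (indF A) (coinvF A)) (functor1 (hopfCat A))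
    ind_counit ind_counit_natural.

(** The triangle identities amount to [a (1 ⊗ n) = a ⊗ n] in the induced module and [1 m = m] in the
    coinvariants. *)
Lemma ind_coinv_adjunction : is_adjunction ind_unit_nat ind_counit_nat.
Proof.
split=> [N|M].
- apply: hopf_hom_ind_ext => a n.
  by rewrite /= ind_mapE left_adjunct_funE /= ind_actE ca_mul1r.
- apply: gmod_hom_eq => m; apply: val_inj; rewrite /= left_adjunct_funE.
  by have [_ _ h1 _] := hm_module M.
Qed.

End HomAdjunction.

Theorem proposition3p16 (k : fieldType) (G : groupType)
    (G_abelian : forall g g' : G, (g * g' = g' * g)%g)
    (b : bichar k G) (H : colourHopf b) (A : comodAlg H) :
  exists (Psi : forall (N : gmod (coinv_alg A)) (M : hopfMod A),
            {linear hopf_hom (ind_hopf N) M -> gmod_hom N (coinv_gmod M)})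
         (Psi' : forall (N : gmod (coinv_alg A)) (M : hopfMod A),
            gmod_hom N (coinv_gmod M) -> hopf_hom (ind_hopf N) M),
  [/\ forall N M (f : hopf_hom (ind_hopf N) M) (n : N),
        val ((Psi N M f : gmod_hom N (coinv_gmod M)) n) = f (tB (ca_one A) n),
      forall N M (g : gmod_hom N (coinv_gmod M)) (a : A) (n : N),
        Psi' N M g (tB a n) = hm_act M a (val (g n)),
      forall N M, cancel (Psi N M) (Psi' N M) /\ cancel (Psi' N M) (Psi N M),
      forall (N N' : gmodCat (coinv_alg A)) (M M' : hopfCat A)
        (u : mor N' N) (v : mor M M') (f : mor (indF A N) M),
        Psi N' M' (v ∘ f ∘ fmap (indF A) u) =
        fmap (coinvF A) v ∘ (Psi N M f : mor N (coinvF A M)) ∘ u &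
      exists (eta : nattrans (functor1 (gmodCat (coinv_alg A)))
                             (functorM (coinvF A) (indF A)))
             (alpha : nattrans (functorM (indF A) (coinvF A))
                               (functor1 (hopfCat A))),
      [/\ forall (N : gmod (coinv_alg A)) (n : N),
            val ((eta N : gmod_hom N (coinv_gmod (ind_hopf N))) n) = tB (ca_one A) n,
          forall (M : hopfMod A) (a : A) (m : coinv_gmod M),
            (alpha M : hopf_hom (ind_hopf (coinv_gmod M)) M) (tB a m) =
            hm_act M a (val m),
          forall (N : gmod (coinv_alg A)),
            eta N = Psi N (ind_hopf N) (idm (ind_hopf N : hopfCat A)),
          forall (M : hopfMod A),
            alpha M = Psi' (coinv_gmod M) M
                        (idm (coinv_gmod M : gmodCat (coinv_alg A))) &
          is_adjunction eta alpha]].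
Proof.
exists (fun N M => @right_adjunct k G b H A N M),
  (fun N M => @left_adjunct k G b H A N M).
split=> [//|N M g a n|N M|N N' M M' u v f|].
- exact: left_adjunctE.
- by split; [exact: right_adjunctK|exact: left_adjunctK].
(* Naturality in both variables: each side sends [n] to [v (f (1 ⊗ u n))]. *)
- apply: gmod_hom_eq => n; apply: val_inj.
  by rewrite /= ind_mapE.
- exists (ind_unit_nat A), (ind_counit_nat A).
  (* The formula for [eta] and the expressions of [eta] and [alpha] as adjuncts of identities hold
     by unfolding definitions. *)
  split=> // [M a m|]; first exact: ind_counitE.
  exact: ind_coinv_adjunction.
Qed.
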